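(* Let $H$ be a finite dimensional complex Hilbert space and let $f: S(C_1(H))\to S(C_1(H))$ be a surjective isometry. Then there exists a surjective isometry $T: C_1(H)\to C_1(H)$ which is complex linear or conjugate linear and satisfies $f(x)=T(x)$ for every $x\in S(C_1(H))$. More concretely, writing $B(H)=M_n(\mathbb{C})$, there exist unitary elements $u,v\in M_n(\mathbb{C})$ such that one of the following statements holds: (a) $f(x)=u x v$ for every $x\in S(C_1(H))$; (b) $f(x)=u x^t v$ for every $x\in S(C_1(H))$; (c) $f(x)=u \overline{x} v$ for every $x\in S(C_1(H))$; (d) $f(x)=u x^* v$ for every $x\in S(C_1(H))$.
   Context: $C_1(H)$ denotes the space of (trace class) operators on $H$ with the trace norm $\|a\|_1=\mathrm{tr}(|a|)$, $|a|=(a^*a)^{1/2}$, and $S(C_1(H))$ is its unit sphere. The map $f$ is an isometry in the metric sense, $\|f(x)-f(y)\|_1=\|x-y\|_1$; no linearity is assumed. With $n=\dim H$ and a fixed orthonormal basis of $H$, operators on $H$ are identified with matrices in $M_n(\mathbb{C})$; $x^t$ is the transpose, $\overline{(x_{ij})}=(\overline{x_{ij}})$ is the entrywise complex conjugate, and $x^*$ is the adjoint. *)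

(* Defs.v *)
From HB Require Import structures.
From mathcomp Require Import all_boot all_order all_algebra.
From mathcomp Require Import complex.
From mathcomp Require Import boolp classical_sets reals.
From mathcomp Require Import ring.

Set Implicit Arguments.
Unset Strict Implicit.
Unset Printing Implicit Defensive.

Import Order.TTheory GRing.Theory Num.Theory.
Import passmx.

Local Open Scope ring_scope.
Local Open Scope sesquilinear_scope.

Section TraceNorm.
Variables (R : realType) (H : vectType R[i]) (dot : {dot H for Num.conj}).
Implicit Types (a b c : 'End(H)).

Definition is_adjoint a b : Prop := forall x y : H, dot (a x) y = dot x (b y).

(* Total by choice; [adjointP] and [adjoint_uniq] show that the adjoint exists
   and is unique, so the default value [0] is never used. *)
Definition adjoint a : 'End(H) := xget 0 [set b | is_adjoint a b].

(* Over the complex numbers this forces [b] to be self-adjoint: [0 <= z] in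
   [R[i]] means that [z] is real and non-negative. *)
Definition positive_op b : Prop := forall x : H, 0 <= dot (b x) x.

Definition is_abs a b : Prop :=
  positive_op b /\ (b \o b)%VF = (adjoint a \o a)%VF.

(* |a| = (a^* a)^{1/2}; existence and uniqueness: [absopP], [absop_uniq]. *)
Definition absop a : 'End(H) := xget 0 [set b | is_abs a b].

(* The trace does not depend on the basis; any basis of [H] would do. *)
Definition optrace b : R[i] :=
  \tr (mxof (vbasis fullv) (vbasis fullv) b).

Definition trnorm a : R[i] := optrace (absop a).

Definition trsphere := {a : 'End(H) | trnorm a == 1}.

Definition orthonormal_basis n (e : n.-tuple H) : Prop :=
  basis_of fullv e /\ orthonormal dot e.

(* The usual matrix of [a] in the orthonormal basis [e], acting on column
   vectors ([passmx.mxof] is its transpose); [dot] is linear in its first argument. *)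
Definition opmx n (e : n.-tuple H) a : 'M[R[i]]_n :=
  \matrix_(i, j) dot (a (tnth e j)) (tnth e i).

End TraceNorm.

Section Maps.
Variables (R : realType) (H : vectType R[i]) (dot : {dot H for Num.conj}).
Implicit Type T : 'End(H) -> 'End(H).

Definition conj_linear T : Prop :=
  linear_for ((Num.conj : R[i] -> R[i]) \; *:%R) T.

Definition trnorm_isometry T : Prop :=
  forall a b, trnorm dot (T a - T b) = trnorm dot (a - b).
End Maps.

Section AdjointAbs.
Variables (R : realType) (H : vectType R[i]) (dot : {dot H for Num.conj}).
Implicit Types (a b c : 'End(H)).

Lemma dotC x y : dot x y = (dot y x)^*.
Proof. by rewrite (hermC dot) expr0 mul1r. Qed.

Lemma orthonormal_seq_ex k : (k <= \dim {:H})%N ->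
  exists2 s : seq H, size s = k & orthonormal dot s.
Proof.
elim: k => [|k IH] kH; first by exists [::].
have [s sk os] := IH (ltnW kH).
have : ~~ (fullv <= <<s>>)%VS.
  apply: contraL kH => /dimvS le; rewrite -leqNgt (leq_trans le) //.
  by rewrite -sk dim_span.
case/subvPn => beta _ bs.
have [X SX [Y [eb _ oY]]] := orthogonal_split dot s beta.
have Y0 : Y != 0 by apply: contraNneq bs => Y0; rewrite eb Y0 addr0.
have dY : 0 < dot Y Y by rewrite dnorm_gt0.
pose c := (sqrtC (dot Y Y))^-1.
exists (c *: Y :: s); first by rewrite /= sk.
have /andP[n1 n2] := os.
rewrite /orthonormal /= n1 n2 !andbT; apply/andP; split.
  rewrite dnormZ /c normfV exprVn ger0_norm ?sqrtC_ge0 ?ltW // sqrtCK.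
  by rewrite mulVf // gt_eqF.
apply/allP => v vs /=; rewrite linearZl_LR /=.
by move/orthoPl: oY => /(_ v vs) ->; rewrite mulr0.
Qed.

Lemma orthonormal_basis_ex :
  exists e : (\dim {:H}).-tuple H, orthonormal_basis dot e.
Proof.
have [s ss os] := orthonormal_seq_ex (leqnn _).
exists (tcast ss (in_tuple s)).
have E : tcast ss (in_tuple s) = s :> seq H.
  by case: _ / ss.
split; rewrite E //.
by rewrite basisEfree (orthonormal_free os) subvf /= ss leqnn.
Qed.

Lemma is_adjoint_uniq a b c : is_adjoint dot a b -> is_adjoint dot a c -> b = c.
Proof.
move=> ab ac; apply/lfunP => y; apply/eqP; rewrite -subr_eq0.
by rewrite -(dnorm_eq0 dot) linearBr /= -ab -ac subrr.
Qed.

Section Basis.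
Variables (e : (\dim {:H}).-tuple H) (eP : orthonormal_basis dot e).
Let eB : basis_of fullv e := proj1 eP.

Lemma dot_onb i j : dot e`_i e`_j =
  if (i < \dim {:H})%N && (j < \dim {:H})%N then (i == j)%:R else 0.
Proof.
have [ue oe] := orthonormalP (proj2 eP).
case: ltnP => iN /=; last first.
  by rewrite (nth_default _ (_ : size e <= i)%N) ?size_tuple // linear0l.
case: ltnP => jN; last first.
  by rewrite (nth_default _ (_ : size e <= j)%N) ?size_tuple // linear0r.
by rewrite oe ?mem_nth ?size_tuple // nth_uniq ?size_tuple.
Qed.

Lemma dot_rVof x y : dot x y = (rVof e x *m (rVof e y)^t*) 0 0.
Proof.
rewrite -{1}(rVofK eB x) -{1}(rVofK eB y) /vecof linear_sumlz mxE.
apply: eq_bigr => i _; rewrite linearZl_LR linear_sumr /= (bigD1 i) //= big1.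
  by rewrite linearZr_LR /= dot_onb !ltn_ord eqxx mulr1 addr0 !mxE.
move=> j /negPf ji; rewrite linearZr_LR /= dot_onb !ltn_ord /=.
by rewrite eq_sym (inj_eq val_inj) ji mulr0.
Qed.

Lemma is_adjoint_ex a : is_adjoint dot a (hommx e e ((mxof e e a)^t*)).
Proof.
move=> x y; rewrite !dot_rVof (rVof_app _ eB) -(rVof_mul eB eB).
by rewrite trmx_mul map_mxM /= trmxCK mulmxA.
Qed.

Lemma form_ge0 n (z : 'rV[R[i]]_n) : 0 <= (z *m z^t*) 0 0.
Proof.
by rewrite mxE sumr_ge0 // => i _; rewrite !mxE -normCK exprn_ge0.
Qed.

Lemma psd_sqrt n (M : 'M[R[i]]_n) :
  exists2 B : 'M[R[i]]_n, B *m B = M *m M^t* &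
    forall x : 'rV_n, 0 <= (x *m B *m x^t*) 0 0.
Proof.
pose A := M *m M^t*.
have An : A \is normalmx.
  by apply/normalmxP; rewrite /A trmx_mul map_mxM /= trmxCK.
have /orthomx_spectralP As := An.
set P := spectralmx A in As; set d := spectral_diag A in As.
have Pu : P \is unitarymx := spectral_unitarymx A.
have PU := unitarymxP Pu.
have PU2 : P^t* *m P = 1%:M by rewrite -(invmx_unitary Pu) mulVmx ?unitarymx_unit.
rewrite (invmx_unitary Pu) in As.
have D : diag_mx d = (P *m M) *m (P *m M)^t*.
  rewrite trmx_mul map_mxM /= mulmxA -(mulmxA P) -/A As !mulmxA PU mul1mx.
  by rewrite -mulmxA PU mulmx1.
have d0 i : 0 <= d 0 i.
  have := congr1 (fun X : 'M__ => X i i) D; rewrite mxE eqxx mulr1n => ->.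
  by rewrite mxE sumr_ge0 // => k _; rewrite !mxE -normCK exprn_ge0.
exists (P^t* *m diag_mx (map_mx sqrtC d) *m P).
  rewrite -/A As !mulmxA -(mulmxA _ P) PU mulmx1 -(mulmxA _ (diag_mx _) (diag_mx _)).
  congr (_ *m _ *m _); rewrite mulmx_diag; congr diag_mx; apply/rowP => i.
  by rewrite !mxE -expr2 sqrtCK.
move=> x; pose z := x *m P^t*.
have -> : x *m (P^t* *m diag_mx (map_mx sqrtC d) *m P) *m x^t* =
          z *m diag_mx (map_mx sqrtC d) *m z^t*.
  by rewrite /z trmx_mul map_mxM /= trmxCK !mulmxA.
rewrite mxE sumr_ge0 // => i _; rewrite mul_mx_diag !mxE mulrAC -normCK.
by rewrite mulr_ge0 ?exprn_ge0 // sqrtC_ge0.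
Qed.
End Basis.

Lemma adjointP a x y : dot (a x) y = dot x (adjoint dot a y).
Proof.
have [e eP] := orthonormal_basis_ex.
rewrite /adjoint; case: xgetP => [b _ /= -> //|/(_ _ (is_adjoint_ex eP a))[]].
Qed.

Lemma adjoint_uniq a b : is_adjoint dot a b -> b = adjoint dot a.
Proof. by move=> ab; apply: (is_adjoint_uniq ab) => x y; exact: adjointP. Qed.

Lemma absopP a : is_abs dot a (absop dot a).
Proof.
have [e eP] := orthonormal_basis_ex; have eB := proj1 eP.
have [B B2 Bge] := psd_sqrt (mxof e e a).
rewrite /absop; case: xgetP => [b _ //|/(_ (hommx e e B))[]] /=; split.
  by move=> x; rewrite (dot_rVof eP) -(rVof_mul eB eB) Bge.
rewrite -(adjoint_uniq (is_adjoint_ex eP a)) -(hommx_mul eB eB eB) // B2.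
rewrite (hommx_mul eB eB eB) //.
by rewrite (mxofK eB).
Qed.

Lemma positive_op_sa b : positive_op dot b -> is_adjoint dot b b.
Proof.
move=> b0 x y.
have real z : dot (b z) z = dot z (b z).
  by rewrite [RHS]dotC conj_Creal // ger0_real.
pose g u v := dot (b u) v - dot u (b v).
have g0 z : g z z = 0 by rewrite /g real subrr.
have gD (k : R[i]) : k^* * g x y + k * g y x = 0.
  have : g (x + k *: y) (x + k *: y) =
      g x x + k^* * g x y + k * g y x + k * k^* * g y y.
    have L u v w : dot (u + k *: v) w = dot u w + k * dot v w.
      by rewrite linearDl linearZl_LR.
    have L' u v w : dot w (u + k *: v) = dot w u + k^* * dot w v.
      by rewrite linearD linearZ.
    have Lb : b (x + k *: y) = b x + k *: b y by rewrite linearD linearZ.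
    by rewrite /g Lb !L !L'; ring.
  by rewrite !g0 mulr0 addr0 add0r.
have := gD 1; have := gD 'i; rewrite conjCi conjC1 !mul1r mulNr addrC => /eqP.
rewrite subr_eq0 => /eqP /(mulfI (neq0Ci _)) -> /eqP.
by rewrite -mulr2n mulrn_eq0 /= subr_eq0 => /eqP.
Qed.

Lemma sa_eigen h : is_adjoint dot h h -> h != 0 ->
  exists x s, [/\ x != 0, s != 0 & h x = s *: x].
Proof.
move=> hs h0; have [e eP] := orthonormal_basis_ex; have eB := proj1 eP.
pose M := mxof e e h.
have Mh : M^t* = M.
  apply: (can_inj (hommxK eB eB)); rewrite (mxofK eB eB).
  exact: is_adjoint_uniq (is_adjoint_ex eP h) hs.
have Mn : M \is normalmx by apply/normalmxP; rewrite Mh.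
have /orthomx_spectralP Ms := Mn.
set P := spectralmx M in Ms; set d := spectral_diag M in Ms.
have PU : P \in unitmx := spectral_unit M.
have [i di] : exists i, d 0 i != 0.
  apply/existsP; apply: contra_neqT h0 => /existsPn dz.
  apply/eqP; rewrite -(mxof_eq0 eB eB) -/M Ms.
  suff -> : d = 0 by rewrite linear0 mulmx0 mul0mx.
  by apply/rowP => j; rewrite mxE; apply/eqP; rewrite -[_ == _]negbK dz.
exists (vecof e (row i P)), (d 0 i); split=> //.
  rewrite (vecof_eq0 eB); apply: contraTneq PU => Pi.
  rewrite -row_free_unit; apply/negP => /row_freeP [B PB].
  have := congr1 (row i) PB; rewrite row_mul Pi mul0mx => /rowP/(_ i).
  by rewrite !mxE eqxx => /esym/eqP; rewrite oner_eq0.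
rewrite (hom_vecof _ eB) -/M -row_mul Ms !mulmxA mulmxV // mul1mx.
rewrite -linearZ; congr vecof; apply/rowP => k.
by rewrite mul_diag_mx !mxE.
Qed.

Lemma is_abs_uniq a b c : is_abs dot a b -> is_abs dot a c -> b = c.
Proof.
move=> [b0 b2] [c0 c2].
have bs := positive_op_sa b0; have cs := positive_op_sa c0.
apply/eqP; rewrite -subr_eq0; apply/negPn/negP => h0.
have hs : is_adjoint dot (b - c) (b - c).
  by move=> x y; rewrite !lfun_simp linearBl linearBr /= bs cs.
have [x [s [x0 s0 hx]]] := sa_eigen hs h0.
have nx : dot x x != 0 by rewrite dnorm_eq0.
have L k u v : dot (k *: u) v = k * dot u v by rewrite linearZl_LR.
have L' k u v : dot u (k *: v) = k^* * dot u v by rewrite linearZ.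
have sr : s^* = s by apply: (mulIf nx); move: (hs x x); rewrite hx L L' => ->.
have E : dot (b ((b - c) x)) x + dot ((b - c) (c x)) x = 0.
  rewrite -linearDl !lfun_simp linearB /= addrA subrK -!comp_lfunE b2 c2.
  by rewrite subrr linear0l.
have bsx : b (s *: x) = s *: b x by rewrite linearZ.
rewrite hs hx bsx L L' sr -mulrDr in E.
move/eqP: E; rewrite mulf_eq0 (negPf s0) paddr_eq0 //= => /andP[/eqP bx /eqP cx].
have : dot ((b - c) x) x = 0 by rewrite !lfun_simp linearBl /= bx cx subrr.
by rewrite hx L => /eqP; rewrite mulf_eq0 (negPf s0) (negPf nx).
Qed.

Lemma absop_uniq a b : is_abs dot a b -> b = absop dot a.
Proof. by move=> ab; exact: is_abs_uniq ab (absopP a). Qed.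

End AdjointAbs.

(* Main.v *)
Require Import Defs.
From HB Require Import structures.
From mathcomp Require Import all_boot all_order all_algebra.
From mathcomp Require Import complex.
From mathcomp Require Import boolp classical_sets reals.
From mathcomp Require Import ring lra.

(* The trace norm of a matrix x is the maximum of Re tr(c x) over unitary c; let
   A(x) be the set of maximizers. On the unit sphere, |x - y| = 2 iff A(x) meets
   -A(y), and |x + y| = 2 iff A(x) meets A(y). Since A(c^H / n) = {c}, inclusions
   between the sets {z : |x - z| = 2} are the inclusions between the A(x). Hence f
   preserves the x with A(x) maximal, which are the rank-one elements, and the x
   with A(x) a singleton, thus also the relation |x + y| = 2; it follows that
   f(-a) = - f(a) for a of rank one. For unit vectors and a = x y, b = x' y',
     |a +- b|^2 = 2 +- 2 Re tr(a b^H) + 2 sqrt((1 - |<x,x'>|^2)(1 - |<y,y'>|^2)),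
   so on rank-one elements f preserves Re tr(a b^H), orthogonality, and the relation
   of sharing a row or column space. Orthogonality yields orthonormal frames in which
   f fixes every matrix unit e_kk; after a transposition f then maps every e_ij to a
   unimodular multiple of itself, so f acts on each entry as a rotation or a
   reflection of the complex plane, and the vanishing of 2 x 2 minors makes the
   phases multiplicative and the choice between the two uniform. Finally, a point of
   the sphere is determined by its distances to the rank-one elements. *)

Set Implicit Arguments.
Unset Strict Implicit.
Unset Printing Implicit Defensive.

Import Order.TTheory GRing.Theory Num.Theory.
Import passmx.

Local Open Scope ring_scope.
Local Open Scope sesquilinear_scope.

(* Locked, because unification otherwise unfolds products of adjoints. *)
HB.lock Definition adjmx (R : realType) m n (A : 'M[R[i]]_(m, n)) : 'M[R[i]]_(n, m) := A^t*.
Notation "A ^H" := (adjmx A) (at level 30, format "A ^H") : ring_scope.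

(** * Adjoints, unitaries and singular values *)

Section SingularValues.
Variable R : realType.
Local Notation C := R[i].
Local Notation re := (@complex.Re R).
Local Notation "x %:C" := (real_complex R x).

Lemma adjmxE m n (A : 'M[C]_(m, n)) i j : A^H i j = (A j i)^*.
Proof. by rewrite adjmx.unlock !mxE. Qed.

Lemma adjmxK m n (A : 'M[C]_(m, n)) : A^H^H = A.
Proof. by rewrite adjmx.unlock trmxCK. Qed.

Lemma adjmxM m n p (A : 'M[C]_(m, n)) (B : 'M[C]_(n, p)) :
  (A *m B)^H = B^H *m A^H.
Proof. by rewrite adjmx.unlock trmx_mul map_mxM. Qed.

Lemma adjmxD m n (A B : 'M[C]_(m, n)) : (A + B)^H = A^H + B^H.
Proof. by rewrite adjmx.unlock linearD map_mxD. Qed.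

Lemma adjmxN m n (A : 'M[C]_(m, n)) : (- A)^H = - A^H.
Proof. by rewrite adjmx.unlock linearN map_mxN. Qed.

Lemma adjmxZ m n z (A : 'M[C]_(m, n)) : (z *: A)^H = z^* *: A^H.
Proof. by rewrite adjmx.unlock linearZ map_mxZ. Qed.

Lemma adjmx1 n : (1%:M : 'M[C]_n)^H = 1%:M.
Proof. by rewrite adjmx.unlock trmx1 map_mx1. Qed.

Lemma adj_delta m n (i : 'I_m) (j : 'I_n) : (delta_mx i j : 'M[C]_(m, n))^H = delta_mx j i.
Proof. by rewrite adjmx.unlock trmx_delta map_delta_mx. Qed.

(* A [Prop] rather than the boolean [unitarymx], whose comparison up to conversion
   is very costly. *)
Record unitary n (u : 'M[C]_n) : Prop := Unitary { unitaryP : u *m u^H = 1%:M }.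

Lemma unitarymxE n (u : 'M[C]_n) : u \is unitarymx <-> unitary u.
Proof.
by split=> [/unitarymxP uu|[uu]]; [split | apply/unitarymxP]; move: uu; rewrite adjmx.unlock.
Qed.

Lemma unitary_adjK n (u : 'M[C]_n) : unitary u -> u^H *m u = 1%:M.
Proof. by case=> /mulmx1C. Qed.

Lemma unitary1 n : unitary (1%:M : 'M[C]_n).
Proof. by split; rewrite adjmx1 mulmx1. Qed.

Lemma unitary_adj n (u : 'M[C]_n) : unitary u -> unitary (u^H).
Proof. by move=> uU; split; rewrite adjmxK unitary_adjK. Qed.

Lemma unitaryN n (u : 'M[C]_n) : unitary u -> unitary (- u).
Proof. by case=> uU; split; rewrite adjmxN mulmxN mulNmx opprK. Qed.

Lemma unitaryM n (u v : 'M[C]_n) : unitary u -> unitary v -> unitary (u *m v).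
Proof.
by case=> uU [vU]; split; rewrite adjmxM mulmxA -(mulmxA u) vU mulmx1 uU.
Qed.

Lemma unitaryT n (u : 'M[C]_n) : unitary u -> unitary (u^T).
Proof.
move=> /unitary_adjK /(congr1 trmx); rewrite trmx1 => uU; split.
rewrite -[RHS]uU trmx_mul; congr (_ *m _).
by apply/matrixP => i j; rewrite !(adjmxE, mxE).
Qed.

Lemma reJ (z : C) : re z^* = re z.
Proof. by case: z. Qed.

Lemma reM_real (z : C) (r : R) : re (z * r%:C) = re z * r.
Proof. by case: z => a b /=; rewrite mulr0 subr0. Qed.

Lemma conj_real (r : R) : (r%:C)^* = r%:C.
Proof. by rewrite conj_Creal // complex_real. Qed.

(** The squared modulus as an element of [R], so that it can be summed and compared there. *)
Definition sqn (z : C) : R := re z ^+ 2 + complex.Im z ^+ 2.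

Lemma sqnE z : z * z^* = (sqn z)%:C.
Proof.
case: z => a b; rewrite /sqn; apply/eqP; rewrite eq_complex /=.
by apply/andP; split; apply/eqP; ring.
Qed.

Lemma sqn_ge0 z : 0 <= sqn z.
Proof. by rewrite addr_ge0 ?sqr_ge0. Qed.

Lemma sqn_eq0 z : (sqn z == 0) = (z == 0).
Proof.
by case: z => a b; rewrite /sqn paddr_eq0 ?sqr_ge0 // !sqrf_eq0 eq_complex.
Qed.

Lemma re_sum I (r : seq I) (P : pred I) (F : I -> C) :
  re (\sum_(i <- r | P i) F i) = \sum_(i <- r | P i) re (F i).
Proof. exact: (big_morph re (id1 := 0) (op1 := +%R) (fun x y => raddfD _ x y)). Qed.

Lemma realC_sum I (r : seq I) (P : pred I) (F : I -> R) :
  \sum_(i <- r | P i) (F i)%:C = (\sum_(i <- r | P i) F i)%:C.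
Proof. by rewrite rmorph_sum. Qed.

Definition rtr n (x : 'M[C]_n) : R := re (\tr x).

Lemma rtrD n (x y : 'M[C]_n) : rtr (x + y) = rtr x + rtr y.
Proof. by rewrite /rtr mxtraceD raddfD. Qed.
Lemma rtrN n (x : 'M[C]_n) : rtr (- x) = - rtr x.
Proof. by rewrite /rtr raddfN /= raddfN. Qed.
Lemma rtrB n (x y : 'M[C]_n) : rtr (x - y) = rtr x - rtr y.
Proof. by rewrite rtrD rtrN. Qed.
Lemma rtrC m n (x : 'M[C]_(m, n)) (y : 'M[C]_(n, m)) : rtr (x *m y) = rtr (y *m x).
Proof. by rewrite /rtr mxtrace_mulC. Qed.
Lemma rtrJ n (x : 'M[C]_n) : rtr (x^H) = rtr x.
Proof.
rewrite /rtr /mxtrace !re_sum; apply: eq_bigr => i _.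
by rewrite !(adjmxE, mxE) reJ.
Qed.

Lemma tr_adj_mul m n (x : 'M[C]_(m, n)) :
  \tr (x *m x^H) = (\sum_i \sum_j sqn (x i j))%:C.
Proof.
rewrite -realC_sum; apply: eq_bigr => i _; rewrite mxE -realC_sum.
by apply: eq_bigr => j _; rewrite !(adjmxE, mxE) sqnE.
Qed.

Lemma adj_mul_eq0 m n (x : 'M[C]_(m, n)) : rtr (x *m x^H) = 0 -> x = 0.
Proof.
rewrite /rtr tr_adj_mul /= => /eqP; rewrite psumr_eq0; last first.
  by move=> i _; rewrite sumr_ge0 // => j _; exact: sqn_ge0.
move=> /allP h; apply/matrixP => i j; rewrite mxE; apply/eqP.
have := h i (mem_index_enum _) => /=; rewrite psumr_eq0; last by move=> k _; exact: sqn_ge0.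
by move=> /allP/(_ j (mem_index_enum _)) /=; rewrite sqn_eq0.
Qed.

Lemma rtr_adj_ge0 m n (x : 'M[C]_(m, n)) : 0 <= rtr (x *m x^H).
Proof.
rewrite /rtr tr_adj_mul /=; rewrite sumr_ge0 // => i _.
by rewrite sumr_ge0 // => j _; exact: sqn_ge0.
Qed.

Definition rdiag n (d : 'I_n -> R) : 'M[C]_n := diag_mx (\row_i (d i)%:C).

Lemma adj_rdiag n (d : 'I_n -> R) : (rdiag d)^H = rdiag d.
Proof.
apply/matrixP => i j; rewrite adjmxE !mxE eq_sym.
by case: eqP => [->|_]; rewrite ?conj_real // conjC0.
Qed.

(* By induction on the number of zero rows: a zero row makes [y] singular, and can be
   replaced by a nonzero vector orthogonal to all rows. *)
Lemma ortho_rows n (y : 'M[C]_n) :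
  (forall i j, i != j -> (y *m y^H) i j = 0) ->
  exists2 w : 'M[C]_n, unitary w &
    exists2 d : 'I_n -> R, forall i, 0 <= d i & y = rdiag d *m w.
Proof.
have [k] := ubnP #|[pred i | row i y == 0]|.
elim: k => // k IH in y *; rewrite ltnS => ck oy.
have [/existsP [i /eqP yi]|/existsPn ny] := boolP [exists i, row i y == 0].
  have k0 : kermx (y^H) != 0.
    apply/eqP => k0; have /row_freeP [B yB] : row_free (y^H) by rewrite -kermx_eq0 k0.
    have /mulmx1C By : B^H *m y = 1%:M by rewrite -(adjmx1 n) -yB adjmxM adjmxK.
    have := congr1 (row i) By; rewrite row_mul yi mul0mx => /rowP/(_ i).
    by rewrite !(adjmxE, mxE) eqxx => /esym/eqP; rewrite oner_eq0.
  have /rowV0Pn [v] := k0; move/sub_kermxP => vy v0.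
  pose y' := \matrix_k (if k == i then v else row k y).
  have ry' l : row l y' = if l == i then v else row l y by rewrite rowK.
  have dot l m (z : 'M[C]_n) : (z *m z^H) l m = (row l z *m (row m z)^H) 0 0.
    by rewrite !(adjmxE, mxE); apply: eq_bigr => p _; rewrite !(adjmxE, mxE).
  have vy' m : (v *m (row m y)^H) 0 0 = 0.
    have := congr1 (fun z : 'rV_n => z 0 m) vy; rewrite [LHS]mxE [RHS]mxE => <-.
    by rewrite mxE; apply: eq_bigr => p _; rewrite !(adjmxE, mxE).
  have yv m : (row m y *m v^H) 0 0 = 0.
    by rewrite -[row m y]adjmxK -adjmxM adjmxE vy' conjC0.
  have [||w wU [d d0 dw]] := IH y'.
  - apply: leq_trans ck; apply: proper_card; apply/fintype.properP; split.
      apply/fintype.subsetP => l; rewrite !inE ry'; case: (eqVneq l i) => // _.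
      by rewrite (negPf v0).
    by exists i; rewrite !inE ?yi // ry' eqxx.
  - move=> l m lm; rewrite dot !ry'; case: (eqVneq l i) => li; last first.
      case: (eqVneq m i) => mi; first exact: yv.
      by rewrite -dot oy.
    case: (eqVneq m i) => mi; last exact: vy'.
    by move: lm; rewrite li mi eqxx.
  (* Giving row [i] the weight 0 turns the factorization of [y'] back into one of [y]. *)
  exists w => //; exists (fun l => if l == i then 0 else d l).
    by move=> l; case: ifP.
  apply/row_matrixP => l; rewrite row_mul row_diag_mx mxE.
  have := congr1 (row l) dw; rewrite ry' row_mul row_diag_mx mxE.
  case: eqVneq => [->|_ ->//].
  by rewrite yi scale0r mul0mx.
(* No row vanishes now: dividing each row by its length makes the matrix unitary. *)
pose d i := Num.sqrt (\sum_j sqn (y i j)).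
have yy i : (y *m y^H) i i = (d i ^+ 2)%:C.
  rewrite sqr_sqrtr ?sumr_ge0 //; last by move=> j _; exact: sqn_ge0.
  by rewrite mxE -realC_sum; apply: eq_bigr => j _; rewrite !(adjmxE, mxE) sqnE.
have d0 i : 0 < d i.
  rewrite sqrtr_gt0 lt_neqAle sumr_ge0 ?andbT; last by move=> j _; exact: sqn_ge0.
  apply: contra (ny i); rewrite eq_sym psumr_eq0; last by move=> j _; exact: sqn_ge0.
  move=> /allP h; apply/eqP/rowP => j; rewrite !mxE; apply/eqP.
  by have := h j (mem_index_enum _); rewrite /= sqn_eq0.
exists (rdiag (fun i => (d i)^-1) *m y); last first.
  exists d; first by move=> i; exact: ltW.
  rewrite mulmxA mulmx_diag -[LHS]mul1mx; congr (_ *m _).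
  by apply/matrixP => i j; rewrite !mxE -rmorphM mulfV // (gt_eqF (d0 _)).
split; rewrite adjmxM mulmxA -(mulmxA _ y).
apply/matrixP => i j; rewrite adj_rdiag mul_mx_diag mxE.
rewrite mul_diag_mx [X in X * _]mxE; case: (eqVneq i j) => [<-|ij].
  rewrite yy !mxE -!rmorphM eqxx /= expr2 mulrA mulVf ?gt_eqF //.
  by rewrite mul1r mulfV // gt_eqF.
by rewrite oy // mulr0 mul0r !mxE (negPf ij).
Qed.

(** If [P] diagonalizes x x^H, then the rows of P x are orthogonal, and [ortho_rows] splits off
    their lengths. *)
Lemma svd n (x : 'M[C]_n) : exists (u v : 'M[C]_n) (d : 'I_n -> R),
  [/\ unitary u, unitary v, forall i, 0 <= d i & x = u *m rdiag d *m v].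
Proof.
pose A := x *m x^H.
have An : A \is normalmx.
  by apply/normalmxP; rewrite /A adjmx.unlock trmx_mul map_mxM /= trmxCK.
have [P Pu [d As]] : exists2 P : 'M[C]_n, unitary P & exists d, A = P^H *m diag_mx d *m P.
  exists (spectralmx A); first exact/unitarymxE/spectral_unitarymx.
  exists (spectral_diag A); rewrite adjmx.unlock.
  rewrite -(invmx_unitary (spectral_unitarymx A)); exact/orthomx_spectralP.
have [|w wU [s s0 Px]] := @ortho_rows _ (P *m x).
  move=> i j ij; rewrite adjmxM mulmxA -(mulmxA P) -/A As !mulmxA.
  by rewrite (unitaryP Pu) mul1mx -mulmxA (unitaryP Pu) mulmx1 mxE (negPf ij).
exists (P^H), w, s; split; [exact: unitary_adj | exact: wU | exact: s0 |].
by rewrite -mulmxA -Px mulmxA (unitary_adjK Pu) mul1mx.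
Qed.

Lemma rtr_rdiag n (w : 'M[C]_n) (d : 'I_n -> R) :
  rtr (w *m rdiag d) = \sum_i re (w i i) * d i.
Proof.
rewrite /rtr /mxtrace re_sum; apply: eq_bigr => i _.
by rewrite mul_mx_diag !mxE reM_real.
Qed.

Lemma unitary_row_sum n (w : 'M[C]_n) i : unitary w ->
  \sum_j sqn (w i j) = 1.
Proof.
move=> /unitaryP /(congr1 (fun z : 'M[C]_n => re (z i i))).
rewrite mxE mxE eqxx re_sum /= => <-.
by apply: eq_bigr => j _; rewrite !(adjmxE, mxE) sqnE.
Qed.

Lemma unitary_re_le n (w : 'M[C]_n) i j : unitary w -> re (w i j) <= 1.
Proof.
move=> /(unitary_row_sum i); rewrite (bigD1 j) //= => E.
have : sqn (w i j) <= 1.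
  by rewrite -E lerDl sumr_ge0 // => k _; exact: sqn_ge0.
by rewrite /sqn; nra.
Qed.

(** The row has norm one, so nothing is left for the imaginary part of this entry or for the other
    entries. *)
Lemma unitary_re_eq1 n (w : 'M[C]_n) i j : unitary w -> re (w i j) = 1 ->
  row i w = delta_mx 0 j.
Proof.
move=> /(unitary_row_sum i); rewrite (bigD1 j) //= => E w1.
have S0 : 0 <= \sum_(k < n | k != j) sqn (w i k).
  by rewrite sumr_ge0 // => k _; exact: sqn_ge0.
have S1 : \sum_(k < n | k != j) sqn (w i k) = 0.
  by move: E S0; rewrite {1}/sqn w1; nra.
have i0 : complex.Im (w i j) = 0 by move: E; rewrite S1 /sqn w1; nra.
apply/rowP => k; rewrite !mxE eqxx /=; case: eqVneq => [->|kj].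
  by move: w1 i0; case: (w i j) => a b /= -> ->.
move/eqP: S1; rewrite psumr_eq0; last by move=> l _; exact: sqn_ge0.
move=> /allP/(_ k (mem_index_enum _)); rewrite kj /= sqn_eq0 => /eqP ->.
by [].
Qed.

(** By cyclicity the trace is the sum of the re(w_ii) d_i for the unitary w = v c u. Each re(w_ii)
    is at most 1, and w = 1 attains all bounds at once. *)
Lemma rtr_svd_max n (u v : 'M[C]_n) (d : 'I_n -> R) :
  unitary u -> unitary v -> (forall i, 0 <= d i) ->
  (forall c, unitary c -> rtr (c *m (u *m rdiag d *m v)) <= \sum_i d i) /\
  exists2 c, unitary c & rtr (c *m (u *m rdiag d *m v)) = \sum_i d i.
Proof.
move=> uU vU d0.
have E c : rtr (c *m (u *m rdiag d *m v)) = \sum_i re ((v *m c *m u) i i) * d i.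
  by rewrite mulmxA rtrC !mulmxA -rtr_rdiag.
split=> [c cU|].
  rewrite E; apply: ler_sum => i _.
  by rewrite ler_piMl // (unitary_re_le _ _ (unitaryM (unitaryM vU cU) uU)).
exists (v^H *m u^H); first exact: unitaryM (unitary_adj vU) (unitary_adj uU).
rewrite E; apply: eq_bigr => i _.
by rewrite mulmxA (unitaryP vU) mul1mx (unitary_adjK uU) mxE eqxx mul1r.
Qed.

Lemma tn_ex n (x : 'M[C]_n) : exists t : R,
  (forall c, unitary c -> rtr (c *m x) <= t) /\
  exists2 c, unitary c & rtr (c *m x) = t.
Proof.
have [u [v [d [uU vU d0 ->]]]] := svd x.
by exists (\sum_i d i); exact: rtr_svd_max.
Qed.

End SingularValues.

(** The maximum of Re tr(c x) over unitary c; [trnorm_tn] identifies it with the operator trace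
    norm. *)
HB.lock Definition tn (R : realType) n (x : 'M[R[i]]_n) : R := projT1 (cid (tn_ex x)).

Section TraceNormMatrices.
Variable R : realType.
Local Notation C := R[i].
Local Notation re := (@complex.Re R).
Local Notation "x %:C" := (real_complex R x).

Lemma tn_ge n (x c : 'M[C]_n) : unitary c -> rtr (c *m x) <= tn x.
Proof. by rewrite tn.unlock => cU; case: (projT2 (cid (tn_ex x))) => /(_ c cU). Qed.

Lemma tn_attained n (x : 'M[C]_n) : exists2 c, unitary c & rtr (c *m x) = tn x.
Proof. by rewrite tn.unlock; case: (projT2 (cid (tn_ex x))). Qed.

Lemma tn_uniq n (x : 'M[C]_n) t :
  (forall c, unitary c -> rtr (c *m x) <= t) ->
  (exists2 c, unitary c & rtr (c *m x) = t) -> tn x = t.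
Proof.
move=> h [c cU cx]; apply/eqP; rewrite eq_le -{2}cx tn_ge // andbT.
by have [c' c'U <-] := tn_attained x; exact: h.
Qed.

Lemma tn_svd n (u v : 'M[C]_n) (d : 'I_n -> R) : unitary u ->
  unitary v -> (forall i, 0 <= d i) -> tn (u *m rdiag d *m v) = \sum_i d i.
Proof. by move=> uU vU d0; have [le at_] := rtr_svd_max uU vU d0; apply: tn_uniq. Qed.

(** * Norming unitaries and stars *)

Definition norming n (c x : 'M[C]_n) := unitary c /\ rtr (c *m x) = tn x.

Lemma norming_ex n (x : 'M[C]_n) : exists c, norming c x.
Proof. by have [c cU cx] := tn_attained x; exists c. Qed.

(** With w = v c u, norming means that the sum of the re(w_ii) d_i equals the sum of the d_i, hence
    equality in each term: wherever d_i is nonzero, row i of w is the i-th basis vector. *)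
Lemma norming_svd n (c u v : 'M[C]_n) (d : 'I_n -> R) : unitary u ->
  unitary v -> (forall i, 0 <= d i) -> unitary c ->
  norming c (u *m rdiag d *m v) <-> rdiag d *m (v *m c *m u) = rdiag d.
Proof.
move=> uU vU d0 cU.
have wU : unitary (v *m c *m u) by exact: unitaryM (unitaryM vU cU) uU.
rewrite /norming tn_svd //.
have -> : rtr (c *m (u *m rdiag d *m v)) = \sum_i re ((v *m c *m u) i i) * d i.
  by rewrite mulmxA rtrC !mulmxA -rtr_rdiag.
split=> [[_ E]|E]; last first.
  split; first by [].
  apply: eq_bigr => i _.
  have := congr1 (fun z : 'M[C]_n => re (z i i)) E.
  by rewrite mul_diag_mx !mxE eqxx mulrC /= reM_real.
have {}E i : re ((v *m c *m u) i i) * d i = d i.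
  apply/eqP; rewrite eq_le ler_piMl ?(unitary_re_le _ _ wU) //=.
  have : \sum_i (d i - re ((v *m c *m u) i i) * d i) = 0 by rewrite sumrB E subrr.
  move/eqP; rewrite psumr_eq0.
    by move=> /allP/(_ i (mem_index_enum _)) /=; rewrite subr_eq0 => /eqP <-.
  by move=> j _; rewrite subr_ge0 ler_piMl ?(unitary_re_le _ _ wU).
apply/row_matrixP => i; rewrite row_mul row_diag_mx mxE -scalemxAl -rowE.
have [->|di] := eqVneq (d i) 0; first by rewrite !scale0r.
by rewrite (@unitary_re_eq1 _ _ _ i i) //; apply: (mulIf di); rewrite mul1r.
Qed.

Lemma tnN n (x : 'M[C]_n) : tn (- x) = tn x.
Proof.
suff h (y : 'M[C]_n) : tn (- y) <= tn y.
  by apply/eqP; rewrite eq_le h -{1}[x]opprK h.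
have [c cU <-] := tn_attained (- y).
rewrite mulmxN -mulNmx tn_ge //.
exact: unitaryN.
Qed.

Lemma tnD_le n (x y : 'M[C]_n) : tn (x + y) <= tn x + tn y.
Proof.
have [c cU <-] := tn_attained (x + y).
by rewrite mulmxDr rtrD lerD // tn_ge.
Qed.

Lemma tnJ n (x : 'M[C]_n) : tn (x^H) = tn x.
Proof.
suff h (y : 'M[C]_n) : tn (y^H) <= tn y.
  by apply/eqP; rewrite eq_le h -{1}[x]adjmxK h.
have [c cU <-] := tn_attained (y^H).
by rewrite -rtrJ adjmxM adjmxK rtrC; apply: tn_ge; exact: unitary_adj.
Qed.

Lemma tnT n (x : 'M[C]_n) : tn (x^T) = tn x.
Proof.
suff h (y : 'M[C]_n) : tn (y^T) <= tn y.
  by apply/eqP; rewrite eq_le h -{1}[x]trmxK h.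
have [c cU <-] := tn_attained (y^T).
rewrite /rtr -mxtrace_tr trmx_mul trmxK -/(rtr _) rtrC.
by apply: tn_ge; exact: unitaryT.
Qed.

Lemma tnMl n (u x : 'M[C]_n) : unitary u -> tn (u *m x) = tn x.
Proof.
move=> uU; suff h (y w : 'M[C]_n) : unitary w -> tn (w *m y) <= tn y.
  apply/eqP; rewrite eq_le h //=.
  by rewrite -{1}[x]mul1mx -(unitary_adjK uU) -mulmxA; apply: h; exact: unitary_adj.
move=> wU; have [c cU <-] := tn_attained (w *m y).
by rewrite mulmxA; apply: tn_ge; exact: unitaryM.
Qed.

Lemma tnMr n (u x : 'M[C]_n) : unitary u -> tn (x *m u) = tn x.
Proof. by move=> uU; rewrite -tnT trmx_mul (tnMl _ (unitaryT uU)) tnT. Qed.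

Lemma tnZ n (r : R) (x : 'M[C]_n) : 0 <= r -> tn (r%:C *: x) = r * tn x.
Proof.
move=> r0; have [u [v [d [uU vU d0 ->]]]] := svd x.
have -> : r%:C *: (u *m rdiag d *m v) = u *m rdiag (fun i => r * d i) *m v.
  rewrite scalemxAl scalemxAr; congr (_ *m _ *m _).
  by apply/matrixP => i j; rewrite !mxE mulrnAr -rmorphM.
by rewrite !tn_svd // ?mulr_sumr // => i; rewrite mulr_ge0.
Qed.

(** A unitary that attains the norm of the sum must attain the norms of both summands. *)
Lemma tnD_norming n (x y : 'M[C]_n) :
  tn (x + y) = tn x + tn y <-> exists c, norming c x /\ norming c y.
Proof.
split=> [E|[c [[cU cx] [_ cy]]]].
  have [c cU cxy] := tn_attained (x + y); exists c.
  have := tn_ge x cU; have := tn_ge y cU.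
  move: cxy; rewrite mulmxDr rtrD E /norming => *.
  by split; (split; first by []); lra.
apply/eqP; rewrite eq_le tnD_le -cx -cy -rtrD -mulmxDr tn_ge //.
Qed.

(** * Rank-one elements and points with a single norming unitary *)

Definition rank1 n (a : 'M[C]_n) := exists (u v : 'M[C]_n) (i : 'I_n),
  [/\ unitary u, unitary v & a = u *m delta_mx i i *m v].

Lemma delta_rdiag n (i : 'I_n) : delta_mx i i = rdiag (fun k => (k == i)%:R : R).
Proof.
apply/matrixP => k l; rewrite !mxE; case: (eqVneq k l) => [<-|kl].
  by rewrite andbb mulr1n; case: eqP.
rewrite mulr0n; case: (eqVneq k i) => // ki; case: (eqVneq l i) => // li.
by move: kl; rewrite ki li eqxx.
Qed.

Lemma tn_rank1 n (a : 'M[C]_n) : rank1 a -> tn a = 1.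
Proof.
move=> [u [v [i [uU vU ->]]]]; rewrite delta_rdiag tn_svd //.
rewrite (bigD1 i) //= eqxx big1 ?addr0 // => k /negPf -> //.
Qed.

Lemma rank1N n (a : 'M[C]_n) : rank1 a -> rank1 (- a).
Proof.
move=> [u [v [i [uU vU ->]]]]; exists (- u), v, i; split=> //.
  exact: unitaryN.
by rewrite !mulNmx.
Qed.

Lemma norming_rank1 n (c u v : 'M[C]_n) i : unitary u -> unitary v -> unitary c ->
  norming c (u *m delta_mx i i *m v) <->
  delta_mx i i *m (v *m c *m u) = delta_mx i i.
Proof. by move=> uU vU cU; rewrite delta_rdiag; apply: norming_svd. Qed.

(** Row [i] of the criterion in [norming_svd], divided by [d i], is the criterion for this
    component. *)
Lemma norming_component n (c u v : 'M[C]_n) (d : 'I_n -> R) i :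
  unitary u -> unitary v -> (forall j, 0 <= d j) -> d i != 0 ->
  norming c (u *m rdiag d *m v) -> norming c (u *m delta_mx i i *m v).
Proof.
move=> uU vU d0 di cx; have cU := proj1 cx.
move: cx; rewrite norming_svd // norming_rank1 // => E.
have di' : (d i)%:C != 0 by rewrite eq_complex /= eqxx andbT.
have dd : delta_mx i i *m rdiag d = (d i)%:C *: delta_mx i i.
  apply/matrixP => k l; rewrite mul_mx_diag !mxE mulrC.
  by case: (eqVneq l i) => [->//|_]; rewrite andbF !mulr0.
by apply: (scalerI di'); rewrite scalemxAl -dd -(mulmxA (delta_mx i i)) E.
Qed.

Lemma normingN n (c x : 'M[C]_n) : norming c (- x) <-> norming (- c) x.
Proof.
rewrite /norming tnN mulmxN -mulNmx; split=> -[cU ?]; split=> //.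
  exact: unitaryN.
by rewrite -[c]opprK; apply: unitaryN.
Qed.

Lemma near_norming n (x y : 'M[C]_n) : tn x = 1 -> tn y = 1 ->
  tn (x + y) = 2 <-> exists c, norming c x /\ norming c y.
Proof. by move=> x1 y1; rewrite -tnD_norming x1 y1. Qed.

Lemma far_norming n (x y : 'M[C]_n) : tn x = 1 -> tn y = 1 ->
  tn (x - y) = 2 <-> exists c, norming c x /\ norming (- c) y.
Proof.
move=> x1 y1; rewrite near_norming ?tnN //.
by split=> -[c [? /normingN ?]]; exists c.
Qed.

(* The point of the sphere whose only norming unitary is [c]. *)
Definition flat n (c : 'M[C]_n) : 'M[C]_n := (n%:R^-1)%:C *: c^H.

Lemma tn_unitary n (c : 'M[C]_n) : unitary c -> tn c = n%:R.
Proof.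
move=> cU; rewrite -[c]mulmx1 tnMl //.
have -> : 1%:M = 1%:M *m rdiag (fun _ => 1 : R) *m 1%:M :> 'M[C]_n.
  by rewrite mul1mx mulmx1; apply/matrixP => i j; rewrite !mxE.
rewrite tn_svd //; try exact: unitary1.
by rewrite sumr_const card_ord.
Qed.

Lemma rtrZ n (r : R) (x : 'M[C]_n) : rtr (r%:C *: x) = r * rtr x.
Proof. by rewrite /rtr mxtraceZ mulrC reM_real mulrC. Qed.

Lemma tn_flat n (c : 'M[C]_n) : (0 < n)%N -> unitary c -> tn (flat c) = 1.
Proof.
move=> n0 cU; rewrite tnZ ?invr_ge0 ?ler0n // tnJ tn_unitary // mulVf //.
by rewrite pnatr_eq0 -lt0n.
Qed.

(** If Re tr(c' c^H) = n, then the squared Hilbert-Schmidt norm of c' - c is n - n - n + n = 0. *)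
Lemma norming_flat n (c c' : 'M[C]_n) : (0 < n)%N -> unitary c ->
  norming c' (flat c) <-> c' = c.
Proof.
move=> n0 cU; have nn : (n%:R : R) != 0 by rewrite pnatr_eq0 -lt0n.
have t1 : rtr (1%:M : 'M[C]_n) = n%:R by rewrite /rtr mxtrace1 raddfMn.
rewrite /norming tn_flat // /flat -scalemxAr rtrZ.
split=> [[c'U E]|->]; last by split; rewrite ?(unitaryP cU) ?t1 ?mulVf.
apply/eqP; rewrite -subr_eq0; apply/eqP/adj_mul_eq0.
have E' : rtr (c' *m c^H) = n%:R by apply: (mulfI (invr_neq0 nn)); rewrite E mulVf.
rewrite adjmxD adjmxN mulmxDl !mulmxDr !mulmxN !mulNmx opprK.
rewrite (unitaryP cU) (unitaryP c'U) !rtrD !rtrN t1 E'.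
by rewrite -rtrJ adjmxM adjmxK E' subrr add0r addrC subrr.
Qed.

(* Inclusion of the star of [- x] in that of [- y]; metric, hence preserved by [f]. *)
Definition star_sub n (x y : 'M[C]_n) :=
  forall z, tn z = 1 -> tn (x - z) = 2 -> tn (y - z) = 2.

(** Stars can be tested one unitary at a time: [flat (- c)] is at distance 2 from a point exactly
    when [c] norms that point. *)
Lemma star_subP n (x y : 'M[C]_n) : (0 < n)%N -> tn x = 1 -> tn y = 1 ->
  star_sub x y <-> forall c, norming c x -> norming c y.
Proof.
move=> n0 x1 y1; split=> [s c cx|s z z1]; last first.
  by rewrite !far_norming // => -[c [/s cy ?]]; exists c.
have cU := proj1 cx; have NU := unitaryN cU.
have := s (flat (- c)) (tn_flat n0 NU); rewrite !far_norming ?tn_flat //.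
case=> [|c' [c'y]]; first by exists c; split=> //; rewrite norming_flat.
by rewrite norming_flat // => /oppr_inj <-.
Qed.

(** A metric form of having a single norming unitary, as [star_min_flat] and [star_min_norming]
    show. *)
Definition star_min n (z : 'M[C]_n) :=
  forall w, tn w = 1 -> star_sub w z -> star_sub z w.

Lemma star_min_flat n (c : 'M[C]_n) : (0 < n)%N -> unitary c -> star_min (flat c).
Proof.
move=> n0 cU w w1; rewrite !star_subP ?tn_flat // => s c'.
rewrite norming_flat // => ->; have [d dw] := norming_ex w.
by have := s d dw; rewrite norming_flat // => <-.
Qed.

Lemma star_min_norming n (z : 'M[C]_n) : (0 < n)%N -> tn z = 1 -> star_min z ->
  exists c, forall d, norming d z -> d = c.
Proof.
move=> n0 z1 zm; have [c cz] := norming_ex z; have cU := proj1 cz.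
exists c => d dz; have := zm _ (tn_flat n0 cU).
rewrite !star_subP ?tn_flat // => h.
by have := h _ d dz; rewrite norming_flat //; apply=> e; rewrite norming_flat // => ->.
Qed.

(** Expresses |x + y| = 2 by distances alone: if c is the only unitary norming z, then x and y are
    both at distance 2 from z exactly when - c norms both. *)
Lemma near_star_min n (x y : 'M[C]_n) : (0 < n)%N -> tn x = 1 -> tn y = 1 ->
  tn (x + y) = 2 <-> exists z, [/\ tn z = 1, star_min z, tn (z - x) = 2 & tn (z - y) = 2].
Proof.
move=> n0 x1 y1; rewrite near_norming //; split=> [[c [cx cy]]|[z [z1 zm]]].
  have NU := unitaryN (proj1 cx); exists (flat (- c)).
  split; [exact: tn_flat | exact: star_min_flat | |]; rewrite far_norming ?tn_flat //;
    by exists (- c); rewrite norming_flat // opprK.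
have [c cz] := star_min_norming n0 z1 zm.
rewrite !far_norming // => -[d [/cz -> dx]] [d' [/cz -> d'y]].
by exists (- c).
Qed.

Lemma rdiag_sum n (d : 'I_n -> R) : rdiag d = \sum_j (d j)%:C *: delta_mx j j.
Proof.
apply/matrixP => k l; rewrite !mxE summxE (bigD1 k) //= big1.
  by rewrite !mxE eqxx /= addr0 eq_sym; case: eqVneq => _; rewrite ?mulr1 ?mulr0.
by move=> m mk; rewrite !mxE eq_sym (negPf mk) mulr0.
Qed.

Lemma mul_delta_delta n (i j : 'I_n) (A : 'M[C]_n) :
  delta_mx i i *m A *m delta_mx j j = A i j *: delta_mx i j.
Proof.
apply/matrixP => k l; rewrite mxE (bigD1 j) //= big1 ?addr0; last first.
  by move=> m mj; rewrite !mxE (negPf mj) mulr0.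
rewrite mxE (bigD1 i) //= big1 ?addr0; last first.
  by move=> m mi; rewrite !mxE (negPf mi) andbF mul0r.
rewrite !mxE !eqxx andbT /=; case: (k == i) => /=; last by rewrite mul0r mulr0 mul0r.
by rewrite mul1r.
Qed.

(** Negates the i-th basis vector and fixes the others; serves as a test unitary. *)
Definition refl_mx n (i : 'I_n) : 'M[C]_n := 1%:M - 2 *: delta_mx i i.

Lemma adj_refl_mx n (i : 'I_n) : (refl_mx i)^H = refl_mx i.
Proof. by rewrite /refl_mx adjmxD adjmxN adjmx1 adjmxZ adj_delta conj_Creal // realn. Qed.

Lemma refl_mx_unitary n (i : 'I_n) : unitary (refl_mx i).
Proof.
split; rewrite adj_refl_mx /refl_mx mulmxBl mul1mx -scalemxAl mulmxBr mulmx1.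
rewrite -scalemxAr mul_delta_mx scalerBr scalerA.
have -> : 2 * 2 = 2 + 2 :> C by ring.
rewrite [(2 + 2) *: _]scalerDl; move: (2 *: _) => z.
by rewrite opprB addrK subrK.
Qed.

(* Both [c] and [c] times the reflection fixing [u e_i] norm [a]; comparing their
   action forces the vectors of [b] to be multiples of those of [a]. *)
Lemma rank1_sub_eq n (a b : 'M[C]_n) : rank1 a -> rank1 b ->
  (forall c, norming c a -> norming c b) -> b = a.
Proof.
move=> ra rb; have [u [v [i [uU vU Ea]]]] := ra.
have [u' [v' [j [u'U v'U Eb]]]] := rb; move=> sab.
have [c ca] := norming_ex a; have cU := proj1 ca.
have uK := unitary_adjK uU; have uuV := unitaryP uU.
have u'K := unitary_adjK u'U; have ccV := unitaryP cU.
have Ac w : unitary w -> norming w a <-> delta_mx i i *m (v *m w *m u) = delta_mx i i.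
  by move=> wU; rewrite Ea; apply: norming_rank1.
have Bc w : unitary w -> norming w b <-> delta_mx j j *m (v' *m w *m u') = delta_mx j j.
  by move=> wU; rewrite Eb; apply: norming_rank1.
have two0 : (2 : C) != 0 by rewrite pnatr_eq0.
pose s : 'M[C]_n := - refl_mx i.
have sE : s = 2 *: delta_mx i i - 1%:M by rewrite /s /refl_mx opprB.
have dK : delta_mx i i *m delta_mx i i = delta_mx i i :> 'M[C]_n by rewrite mul_delta_mx.
have ds : delta_mx i i *m s = delta_mx i i.
  rewrite sE mulmxBr mulmx1 -scalemxAr dK.
  by rewrite -[X in _ - X]scale1r -scalerBl (_ : 2 - 1 = 1) ?scale1r //; ring.
have sU : unitary s by exact/unitaryN/refl_mx_unitary.
have rU : unitary (u *m s *m u^H).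
  by apply: unitaryM (unitaryM uU sU) (unitary_adj uU).
(* The norming condition recovers the row vector of [a] from [c] and its column vector; [E2] does so
   for [b]. *)
have E1 : delta_mx i i *m v = delta_mx i i *m u^H *m c^H.
  move/(Ac c cU): ca => /(congr1 (fun z => z *m u^H *m c^H)) <-.
  by rewrite -!mulmxA (mulmxA u) uuV mul1mx ccV mulmx1.
have bc := sab c ca.
have E2 : delta_mx j j *m v' = delta_mx j j *m u'^H *m c^H.
  move/(Bc c cU): bc => /(congr1 (fun z => z *m u'^H *m c^H)) <-.
  by rewrite -!mulmxA (mulmxA u') (unitaryP u'U) mul1mx ccV mulmx1.
have bcr : norming (c *m (u *m s *m u^H)) b.
  apply: sab; rewrite Ac; last exact: unitaryM.
  rewrite !mulmxA E1 -!mulmxA (mulmxA (c^H)) (unitary_adjK cU) mul1mx.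
  by rewrite (mulmxA (u^H) u) uK mul1mx mulmx1 ds.
(* Comparing the conditions for the two unitaries shows that row [j] of u'^H u is fixed by 2 e_ii -
   1, hence supported at [i]. *)
have E3 : delta_mx j j *m (u'^H *m u) *m delta_mx i i = delta_mx j j *m (u'^H *m u).
  move: bcr; rewrite Bc; last exact: unitaryM.
  rewrite !mulmxA E2 -!mulmxA (mulmxA (c^H)) (unitary_adjK cU) mul1mx.
  move=> /(congr1 (fun z => z *m u'^H *m u)).
  rewrite -!mulmxA (mulmxA u' (u'^H)) (unitaryP u'U) mul1mx uK mulmx1.
  rewrite sE !mulmxBr !mulmx1 -!scalemxAr => /eqP; rewrite subr_eq -mulr2n.
  move/eqP => h; rewrite !mulmxA in h *.
  by apply: (scalerI two0); rewrite h scaler_nat.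
rewrite mul_delta_delta in E3; set w := (u'^H *m u) j i in E3.
have E4 : delta_mx j j *m u'^H = w *: delta_mx j i *m u^H.
  by rewrite E3 -!mulmxA uuV mulmx1.
have E5 : u' *m delta_mx j j = w^* *: (u *m delta_mx i j).
  rewrite -[LHS]adjmxK adjmxM adj_delta E4 adjmxM adjmxK adjmxZ.
  by rewrite adj_delta -scalemxAr.
have Eba : b = (sqn w)%:C *: a.
  rewrite Eb -(mul_delta_mx j j j) mulmxA E5 -mulmxA E2 E4.
  rewrite -!scalemxAl -scalemxAr scalerA mulrC sqnE -!mulmxA (mulmxA (delta_mx i j)).
  rewrite mul_delta_mx; congr (_ *: _); rewrite Ea -!mulmxA E1.
  by rewrite !mulmxA.
have := tn_rank1 rb; rewrite Eba tnZ ?sqn_ge0 // (tn_rank1 ra) mulr1 => ->.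
by rewrite scale1r.
Qed.

(** If the star of a rank-one x lies in that of y, every unitary norming x norms each singular
    component of y, so all of these equal x by [rank1_sub_eq]. Conversely, a maximal x coincides
    with any of its own singular components. *)
Lemma rank1_star n (x : 'M[C]_n) : (0 < n)%N -> tn x = 1 ->
  rank1 x <-> forall y, tn y = 1 -> star_sub x y -> y = x.
Proof.
move=> n0 x1; split=> [rx y y1|h].
  rewrite star_subP // => s.
  have [u [v [d [uU vU d0 Ey]]]] := svd y.
  have sd : \sum_i d i = 1 by rewrite -(tn_svd uU vU d0) -Ey.
  have E j : (d j)%:C *: (u *m delta_mx j j *m v) = (d j)%:C *: x.
    have [->|dj] := eqVneq (d j) 0; first by rewrite !scale0r.
    congr (_ *: _); apply: rank1_sub_eq => //; first by exists u, v, j.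
    by move=> c /s; rewrite Ey; apply: norming_component.
  rewrite Ey rdiag_sum mulmx_sumr mulmx_suml.
  under eq_bigr => j _ do rewrite -scalemxAr -scalemxAl E.
  by rewrite -scaler_suml realC_sum sd scale1r.
have [u [v [d [uU vU d0 Ex]]]] := svd x.
have sd : \sum_i d i = 1 by rewrite -(tn_svd uU vU d0) -Ex.
have [i di] : exists i, d i != 0.
  apply/existsP; apply: contraT => /existsPn dz; move: sd; rewrite big1.
    by move/eqP; rewrite eq_sym oner_eq0.
  by move=> i _; apply/eqP; rewrite -[_ == _]negbK dz.
have rb : rank1 (u *m delta_mx i i *m v) by exists u, v, i.
suff <- : u *m delta_mx i i *m v = x by [].
apply: h; first exact: tn_rank1.
by rewrite (star_subP n0 x1 (tn_rank1 rb)) Ex => c; apply: norming_component.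
Qed.

(** * What a surjective isometry of the sphere preserves *)

Section Isometry.
Variables (n : nat) (f : 'M[C]_n -> 'M[C]_n).
Hypothesis f_sphere : forall x, tn x = 1 -> tn (f x) = 1.
Hypothesis f_iso : forall x y, tn x = 1 -> tn y = 1 -> tn (f x - f y) = tn (x - y).
Hypothesis f_surj : forall y, tn y = 1 -> exists2 x, tn x = 1 & f x = y.

Lemma star_sub_iso x y : tn x = 1 -> tn y = 1 ->
  star_sub (f x) (f y) <-> star_sub x y.
Proof.
move=> x1 y1; split=> s z z1.
  by have := s (f z) (f_sphere z1); rewrite !f_iso.
by have [w w1 <-] := f_surj z1; rewrite !f_iso //; apply: s.
Qed.

Lemma star_min_iso x : tn x = 1 -> star_min x -> star_min (f x).
Proof.
move=> x1 xm w /f_surj [z z1 <-]; rewrite !star_sub_iso //; exact: xm.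
Qed.

Lemma rank1_iso x : (0 < n)%N -> rank1 x -> rank1 (f x).
Proof.
move=> n0 rx; have x1 := tn_rank1 rx.
rewrite rank1_star //; last exact: f_sphere.
move=> w /f_surj [z z1 <-]; rewrite star_sub_iso // => s; congr f.
by move: rx; rewrite rank1_star //; apply.
Qed.

Lemma near_iso x y : (0 < n)%N -> tn x = 1 -> tn y = 1 ->
  tn (x + y) = 2 -> tn (f x + f y) = 2.
Proof.
move=> n0 x1 y1; rewrite !near_star_min ?f_sphere // => -[z [z1 zm zx zy]].
exists (f z); split; rewrite ?f_iso //; first exact: f_sphere.
exact: star_min_iso.
Qed.

(** As f(-x) has rank one, it suffices by [rank1_star] that each point at distance 2 from f(-x) is
    at distance 2 from - f(x); up to signs this is [near_iso]. *)
Lemma rank1_isoN x : (0 < n)%N -> rank1 x -> f (- x) = - f x.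
Proof.
move=> n0 rx; have x1 := tn_rank1 rx.
have rN := rank1N rx; have N1 := tn_rank1 rN.
apply/esym; have := rank1_iso n0 rN; rewrite rank1_star ?f_sphere //; apply.
  by rewrite tnN f_sphere.
move=> w /f_surj [z z1 <-]; rewrite f_iso // -!opprD !tnN.
exact: near_iso.
Qed.

End Isometry.

(** * The distance between rank-one elements *)

Lemma rtr_rdiag_sq n (u v : 'M[C]_n) (d : 'I_n -> R) : unitary u -> unitary v ->
  let x := u *m rdiag d *m v in rtr (x *m x^H) = \sum_i d i ^+ 2 /\
  rtr ((x *m x^H) *m (x *m x^H)) = \sum_i d i ^+ 4.
Proof.
move=> uU vU x.
have dd (e e' : 'I_n -> R) : rdiag e *m rdiag e' = rdiag (fun i => e i * e' i).
  rewrite /rdiag mulmx_diag; congr diag_mx; apply/rowP => i.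
  by rewrite !mxE -rmorphM.
have xx : x *m x^H = u *m rdiag (fun i => d i ^+ 2) *m u^H.
  rewrite /x !adjmxM adj_rdiag -!mulmxA (mulmxA v) (unitaryP vU) mul1mx.
  by rewrite (mulmxA (rdiag d)) dd !mulmxA.
have tdg (e : 'I_n -> R) : rtr (u *m rdiag e *m u^H) = \sum_i e i.
  rewrite rtrC mulmxA (unitary_adjK uU) rtr_rdiag.
  by apply: eq_bigr => i _; rewrite mxE eqxx mul1r.
split; first by rewrite xx tdg.
rewrite xx -!mulmxA (mulmxA (u^H)) (unitary_adjK uU) mul1mx (mulmxA (rdiag _)) dd mulmxA tdg.
by apply: eq_bigr => i _; rewrite -exprD.
Qed.

Lemma det2 (A : 'M[C]_2) : \det A = A 0 0 * A 1 1 - A 0 1 * A 1 0.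
Proof.
rewrite (expand_det_row _ 0) !big_ord_recl big_ord0 /cofactor !det_mx11 !mxE /= addr0.
rewrite expr0 expr1 mul1r mulN1r mulrN.
by congr (_ * A _ _ - A _ _ * A _ _); apply: val_inj.
Qed.

Lemma tr2 (A : 'M[C]_2) : \tr A = A 0 0 + A 1 1.
Proof.
rewrite /mxtrace !big_ord_recl big_ord0 addr0.
by congr (_ + A _ _); apply: val_inj.
Qed.

Lemma tr_sq2 (A : 'M[C]_2) : \tr A ^+ 2 - \tr (A *m A) = 2 * \det A.
Proof.
rewrite !tr2 det2 !mxE !big_ord_recl !big_ord0 !addr0.
rewrite (_ : lift ord0 ord0 = 1); last exact: val_inj.
by ring.
Qed.

(** The principal submatrix on the nonzero [d i] is invertible and factors through dimension [r]. *)
Lemma diag_rank_support n r (d : 'I_n -> R) (Y : 'M[C]_(n, r)) (Z : 'M[C]_(r, n)) :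
  rdiag d = Y *m Z -> (#|[pred i | d i != 0%R]| <= r)%N.
Proof.
move=> E; pose P := [pred i | d i != 0]; pose g (k : 'I_#|P|) : 'I_n := enum_val k.
have D : diag_mx (\row_k (d (g k))%:C) = rowsub g Y *m colsub g Z.
  apply/matrixP => k l; transitivity ((Y *m Z) (g k) (g l)).
    by rewrite -E !mxE (inj_eq enum_val_inj).
  by rewrite !mxE; apply: eq_bigr => m _; rewrite !mxE.
have /mxrank_unit <- : diag_mx (\row_k (d (g k))%:C) \in unitmx.
  rewrite unitmxE det_diag unitfE; apply/prodf_neq0 => k _; rewrite mxE.
  rewrite eq_complex /= eqxx andbT.
  by have := enum_valP k; rewrite inE.
by rewrite D (leq_trans (mxrankM_maxl _ _)) // rank_leq_col.
Qed.

(** If s and t are the only possibly nonzero values, both sides equal 4 s^2 t^2. *)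
Lemma card_le2_sum n (d : 'I_n -> R) : (#|[pred i | d i != 0%R]| <= 2)%N ->
    ((\sum_i d i) ^+ 2 - \sum_i d i ^+ 2) ^+ 2 =
  2 * ((\sum_i d i ^+ 2) ^+ 2 - \sum_i d i ^+ 4).
Proof.
move=> c2; pose P := [pred i | d i != 0].
have S k : (0 < k)%N -> \sum_i d i ^+ k = \sum_(i <- enum P) d i ^+ k.
  move=> k0; rewrite (bigID P) /= addrC big1 ?add0r; last first.
    by move=> i; rewrite negbK => /eqP ->; rewrite expr0n gtn_eqF.
  by rewrite big_enum.
have -> : \sum_i d i = \sum_i d i ^+ 1 by [].
rewrite !S //; move: c2; rewrite cardE; case: (enum _) => [|i [|j [|k s]]] //= _;
  rewrite !(big_nil, big_cons); ring.
Qed.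

Lemma sum_sq_le n (d : 'I_n -> R) : (forall i, 0 <= d i) ->
  \sum_i d i ^+ 2 <= (\sum_i d i) ^+ 2.
Proof.
move=> d0; rewrite expr2 mulr_suml; apply: ler_sum => i _.
rewrite expr2 ler_wpM2l // (bigD1 i) //= lerDl sumr_ge0 //.
Qed.

(* With singular values [s] and [t], [(s + t)^2 = s^2 + t^2 + 2 s t]; the square of
   [s t] is the second elementary symmetric function of the spectrum of [x x^H], which
   is also that of the 2 x 2 matrix [(Z Z^H) (Y^H Y)]. *)
Lemma tn_rank2 n (Y : 'M[C]_(n, 2)) (Z : 'M[C]_(2, n)) : let x := Y *m Z in
  tn x ^+ 2 =
  rtr (x *m x^H) + 2 * Num.sqrt (re (\det (Y^H *m Y) * \det (Z *m Z^H))).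
Proof.
move=> x; have [u [v [d [uU vU d0 Ex]]]] := svd x.
have [E2 E4] := rtr_rdiag_sq d uU vU; rewrite -Ex in E2 E4.
have T : tn x = \sum_i d i by rewrite Ex tn_svd.
have c2 : (#|[pred i | d i != 0%R]| <= 2)%N.
  apply: (@diag_rank_support _ _ _ (u^H *m Y) (Z *m v^H)).
  rewrite -!mulmxA (mulmxA Y) -/x Ex -!mulmxA (unitaryP vU) mulmx1.
  by rewrite mulmxA (unitary_adjK uU) mul1mx.
have Q := card_le2_sum c2; rewrite -T -E2 -E4 in Q.
have ge0 : 0 <= tn x ^+ 2 - rtr (x *m x^H).
  by rewrite T E2 subr_ge0 sum_sq_le.
suff E : (rtr (x *m x^H)) ^+ 2 - rtr (x *m x^H *m (x *m x^H)) =
    2 * re (\det (Y^H *m Y) * \det (Z *m Z^H)).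
  have {}Q : (tn x ^+ 2 - rtr (x *m x^H)) ^+ 2 = 2 ^+ 2 * re (\det (Y^H *m Y) * \det (Z *m Z^H)).
    by rewrite Q E; ring.
  apply/eqP; rewrite addrC -subr_eq; apply/eqP.
  by rewrite -[LHS]ger0_norm // -sqrtr_sqr Q sqrtrM ?sqr_ge0 // sqrtr_sqr ger0_norm.
pose M := (Z *m Z^H) *m (Y^H *m Y).
have t1 : \tr (x *m x^H) = \tr M.
  by rewrite /x /M adjmxM -!mulmxA mxtrace_mulC -!mulmxA.
have t2 : \tr (x *m x^H *m (x *m x^H)) = \tr (M *m M).
  by rewrite /x /M adjmxM -!mulmxA mxtrace_mulC -!mulmxA.
have := tr_sq2 M; rewrite -t1 -t2 /M det_mulmx [X in _ = 2 * X]mulrC.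
rewrite tr_adj_mul -rmorphXn => /(congr1 re); rewrite raddfB /= /rtr tr_adj_mul /=.
move=> ->; rewrite -[2 : C](rmorph_nat (real_complex R)) mulrC reM_real mulrC //.
Qed.

(** The real part of the Hilbert-Schmidt inner product. *)
Definition rip n (a b : 'M[C]_n) : R := rtr (a *m b^H).

Definition unit_pair n (x : 'cV[C]_n) (y : 'rV[C]_n) :=
  x^H *m x = 1%:M /\ y *m y^H = 1%:M.

(** For unit vectors, the product of the squared sines of the angles between the column spaces and
    between the row spaces. *)
Definition vgap n (x x' : 'cV[C]_n) (y y' : 'rV[C]_n) : R :=
  (1 - sqn ((x^H *m x') 0 0)) * (1 - sqn ((y *m y'^H) 0 0)).

Lemma sqnN (z : C) : sqn (- z) = sqn z.
Proof. by case: z => a b; rewrite /sqn /= !sqrrN. Qed.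

Lemma unit_pairN n (x : 'cV[C]_n) (y : 'rV[C]_n) : unit_pair x y -> unit_pair x (- y).
Proof. by case=> ? ?; split=> //; rewrite adjmxN mulmxN mulNmx opprK. Qed.

Lemma rip_unit n (x : 'cV[C]_n) (y : 'rV[C]_n) : unit_pair x y ->
  rip (x *m y) (x *m y) = 1.
Proof.
case=> xx yy; rewrite /rip adjmxM mulmxA -(mulmxA x) yy mulmx1 rtrC xx.
by rewrite /rtr mxtrace1.
Qed.

Lemma ripC n (a b : 'M[C]_n) : rip a b = rip b a.
Proof. by rewrite /rip -rtrJ adjmxM adjmxK. Qed.

Lemma ripDl n (a b c : 'M[C]_n) : rip (a + b) c = rip a c + rip b c.
Proof. by rewrite /rip mulmxDl rtrD. Qed.

Lemma ripNl n (a b : 'M[C]_n) : rip (- a) b = - rip a b.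
Proof. by rewrite /rip mulNmx rtrN. Qed.

(** The sum is a product of an n x 2 and a 2 x n matrix, so [tn_rank2] applies; the two Gram
    determinants are the factors of [vgap]. *)
Lemma tn_pairD n (x x' : 'cV[C]_n) (y y' : 'rV[C]_n) :
  unit_pair x y -> unit_pair x' y' ->
  tn (x *m y + x' *m y') ^+ 2 =
  2 + 2 * rip (x *m y) (x' *m y') + 2 * Num.sqrt (vgap x x' y y').
Proof.
move=> ux ux'.
pose Y : 'M[C]_(n, 2) := \matrix_(i, j) (if j == 0 then x i 0 else x' i 0).
pose Z : 'M[C]_(2, n) := \matrix_(i, j) (if i == 0 then y 0 j else y' 0 j).
have YZ : x *m y + x' *m y' = Y *m Z.
  apply/matrixP => i j; rewrite !mxE !big_ord_recl !big_ord0 !addr0 !mxE /=.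
  by rewrite !ord1.
rewrite YZ tn_rank2; congr (_ + 2 * Num.sqrt _).
  rewrite -YZ -/(rip _ _) ripDl ![rip _ (_ + _)]ripC !ripDl !rip_unit //.
  by rewrite [rip (x' *m y') _]ripC; ring.
have K (j k : 'I_2) : (Y^H *m Y) j k =
  ((if j == 0 then x else x')^H *m (if k == 0 then x else x')) 0 0.
  rewrite !mxE; apply: eq_bigr => i _; rewrite !(adjmxE, mxE).
  by case: (j == 0); case: (k == 0).
have G (j k : 'I_2) : (Z *m Z^H) j k =
  ((if j == 0 then y else y') *m (if k == 0 then y else y')^H) 0 0.
  rewrite !mxE; apply: eq_bigr => i _; rewrite !(adjmxE, mxE).
  by case: (j == 0); case: (k == 0).
case: ux ux' => xx yy [xx' yy'].
rewrite !det2 !K !G /= xx yy xx' yy'.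
have -> : (x'^H *m x) 0 0 = ((x^H *m x') 0 0)^*.
  by rewrite -adjmxE adjmxM adjmxK.
have -> : (y' *m y^H) 0 0 = ((y *m y'^H) 0 0)^*.
  by rewrite -adjmxE adjmxM adjmxK.
rewrite !sqnE ![1%:M _ _]mxE mulr1 /vgap.
have h (r : R) : 1 - r%:C = (1 - r)%:C by rewrite rmorphB rmorph1.
by rewrite !h -rmorphM.
Qed.

Lemma tn_pairB n (x x' : 'cV[C]_n) (y y' : 'rV[C]_n) :
  unit_pair x y -> unit_pair x' y' ->
  tn (x *m y - x' *m y') ^+ 2 =
  2 - 2 * rip (x *m y) (x' *m y') + 2 * Num.sqrt (vgap x x' y y').
Proof.
move=> ux /unit_pairN ux'; rewrite -mulmxN (tn_pairD ux ux') mulmxN ripC ripNl ripC mulrN.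
have E : (y *m (- y')^H) 0 0 = - (y *m y'^H) 0 0 by rewrite adjmxN mulmxN mxE.
by rewrite /vgap E sqnN.
Qed.

(** With w the inner product, x - w x' has squared norm 1 - |w|^2. *)
Lemma cauchy_sqn n (x x' : 'rV[C]_n) : x *m x^H = 1%:M -> x' *m x'^H = 1%:M ->
  sqn ((x *m x'^H) 0 0) <= 1 /\
  (sqn ((x *m x'^H) 0 0) = 1 -> x = (x *m x'^H) 0 0 *: x').
Proof.
move=> xx xx'; have [w Dw] : exists w, w = (x *m x'^H) 0 0 by exists ((x *m x'^H) 0 0).
rewrite -!Dw.
have Ew : x *m x'^H = w%:M by apply/matrixP => i j; rewrite !ord1 [RHS]mxE.
have E : (x - w *: x') *m (x - w *: x')^H = (1 - sqn w)%:C%:M.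
  rewrite adjmxD adjmxN adjmxZ mulmxDl !mulmxDr !mulmxN !mulNmx opprK.
  rewrite -!scalemxAl -!scalemxAr xx xx' Ew.
  have -> : x' *m x^H = w^*%:M.
    rewrite -[LHS]adjmxK adjmxM adjmxK Ew; apply/matrixP => i j.
    by rewrite !ord1 adjmxE !mxE.
  apply/matrixP => i j; rewrite !ord1 !mxE /=.
  have -> : (1 - sqn w)%:C = 1 - w * w^* by rewrite sqnE rmorphB rmorph1.
  by ring.
have := rtr_adj_ge0 (x - w *: x'); rewrite E /rtr mxtrace_scalar /= => h.
split; first by lra.
move=> w1; apply/eqP; rewrite -subr_eq0; apply/eqP/adj_mul_eq0.
by rewrite E w1 subrr /rtr mxtrace_scalar.
Qed.

Lemma rank1_vec n (a : 'M[C]_n) : rank1 a ->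
  exists (x : 'cV[C]_n) (y : 'rV[C]_n), unit_pair x y /\ a = x *m y.
Proof.
move=> [u [v [i [uU vU ->]]]].
exists (u *m delta_mx i 0), (delta_mx 0 i *m v); split; last first.
  by rewrite [RHS]mulmxA -(mulmxA u (delta_mx i 0)) mul_delta_mx.
split; rewrite adjmxM adj_delta mulmxA.
  by rewrite -(mulmxA _ (u^H)) (unitary_adjK uU) mulmx1 mul_delta_mx;
    apply/matrixP => k l; rewrite !ord1 !mxE.
by rewrite -(mulmxA _ v) (unitaryP vU) mulmx1 mul_delta_mx;
    apply/matrixP => k l; rewrite !ord1 !mxE.
Qed.

(** The matrix whose only nonzero row is [y], at position [i], has orthogonal rows; [ortho_rows]
    completes it to a unitary. *)
Lemma unit_row_unitary n (i : 'I_n) (y : 'rV[C]_n) : y *m y^H = 1%:M ->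
  exists2 v : 'M[C]_n, unitary v & delta_mx 0 i *m v = y.
Proof.
move=> yy; have [|v vU [d d0 E]] := @ortho_rows R n (delta_mx i 0 *m y).
  move=> k l kl; rewrite adjmxM adj_delta mulmxA -(mulmxA _ y) yy mulmx1.
  rewrite mul_delta_mx mxE; case: (eqVneq k i) => //= ki; case: (eqVneq l i) => //= li.
  by move: kl; rewrite ki li eqxx.
have E' : y = (d i)%:C *: (delta_mx 0 i *m v).
  have -> : y = delta_mx (0 : 'I_1) i *m (delta_mx i 0 *m y).
    by rewrite mulmxA mul_delta_mx (_ : delta_mx 0 0 = 1%:M) ?mul1mx //;
      apply/matrixP => k l; rewrite !ord1 !mxE.
  by rewrite E mulmxA -rowE row_diag_mx mxE -scalemxAl.
have vv : (delta_mx 0 i *m v) *m (delta_mx 0 i *m v)^H = 1%:M :> 'M[C]_1.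
  rewrite adjmxM adj_delta mulmxA -(mulmxA _ v) (unitaryP vU) mulmx1 mul_delta_mx.
  by apply/matrixP => k l; rewrite !ord1 !mxE.
have d1 : d i = 1.
  move: yy; rewrite E' adjmxZ -scalemxAl -scalemxAr vv scalerA => /matrixP/(_ 0 0).
  rewrite sqnE !mxE mulr1 => /(congr1 re) /=; rewrite /sqn /= expr0n addr0 => /eqP.
  by rewrite sqrp_eq1 // => /eqP.
by exists v => //; rewrite E' d1 scale1r.
Qed.

Lemma rank1I n (i : 'I_n) (x : 'cV[C]_n) (y : 'rV[C]_n) : unit_pair x y -> rank1 (x *m y).
Proof.
case=> xx yy; have [v vU vy] := unit_row_unitary i yy.
have [|u uU ux] := @unit_row_unitary n i (x^H); first by rewrite adjmxK.
exists (u^H), v, i; split=> //; first exact: unitary_adj.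
rewrite -(mul_delta_mx (0 : 'I_1)) mulmxA -mulmxA vy; congr (_ *m _).
by rewrite -[LHS]adjmxK -ux adjmxM adj_delta.
Qed.

Lemma sqnM (z w : C) : sqn (z * w) = sqn z * sqn w.
Proof. by case: z w => a b [c d]; rewrite /sqn /=; ring. Qed.

Lemma sqnJ (z : C) : sqn z^* = sqn z.
Proof. by case: z => a b; rewrite /sqn /= sqrrN. Qed.

Lemma sqn1 : sqn (1 : C) = 1.
Proof. by rewrite /sqn /= expr1n expr0n addr0. Qed.

Lemma unimodJ (z : C) : sqn z = 1 -> z * z^* = 1.
Proof. by rewrite sqnE => ->. Qed.

Lemma unimod_neq0 (z : C) : sqn z = 1 -> z != 0.
Proof. by rewrite -sqn_eq0 => ->; rewrite oner_eq0. Qed.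

(* For rank-one elements, [adjacent] means that the column spaces or the row spaces
   coincide, and [orthog] that both are orthogonal. *)
Definition adjacent n (a b : 'M[C]_n) := tn (a + b) ^+ 2 + tn (a - b) ^+ 2 = 4.
Definition orthog n (a b : 'M[C]_n) := tn (a + b) ^+ 2 + tn (a - b) ^+ 2 = 8.

(** The square roots in [tn_pairD] and [tn_pairB] are the same and cancel. *)
Lemma tn_rip n (a b : 'M[C]_n) : rank1 a -> rank1 b ->
  4 * rip a b = tn (a + b) ^+ 2 - tn (a - b) ^+ 2.
Proof.
move=> /rank1_vec [x [y [ux ->]]] /rank1_vec [x' [y' [ux' ->]]].
by rewrite (tn_pairD ux ux') (tn_pairB ux ux'); ring.
Qed.

Lemma vgap_factors n (x x' : 'cV[C]_n) (y y' : 'rV[C]_n) :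
  unit_pair x y -> unit_pair x' y' ->
  sqn ((x^H *m x') 0 0) <= 1 /\ sqn ((y *m y'^H) 0 0) <= 1.
Proof.
case=> xx yy [xx' yy']; split; last by case: (cauchy_sqn yy yy').
have := @cauchy_sqn _ (x^H) (x'^H); rewrite !adjmxK => /(_ xx xx') [] //.
Qed.

(** The two squared norms add up to 4 + 4 sqrt([vgap]), so adjacency says that [vgap] vanishes. *)
Lemma adjacentP n (x x' : 'cV[C]_n) (y y' : 'rV[C]_n) :
  unit_pair x y -> unit_pair x' y' ->
  adjacent (x *m y) (x' *m y') <->
  sqn ((x^H *m x') 0 0) = 1 \/ sqn ((y *m y'^H) 0 0) = 1.
Proof.
move=> ux ux'; have [h1 h2] := vgap_factors ux ux'.
rewrite /adjacent (tn_pairD ux ux') (tn_pairB ux ux') /vgap.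
move: h1 h2; move: (sqn _) (sqn _) => q p p1 q1; split=> [E|pq].
  move: E; set s := Num.sqrt _ => E; have /eqP : s = 0 by lra.
  rewrite sqrtr_eq0 => h.
  have /eqP : (1 - p) * (1 - q) = 0.
    by apply/eqP; rewrite eq_le h mulr_ge0 // subr_ge0.
  by rewrite mulf_eq0 !subr_eq0 => /orP[] /eqP <-; [left | right].
have E : (1 - p) * (1 - q) = 0 by case: pq => ->; ring.
by rewrite E sqrtr0; lra.
Qed.

(** Here the same sum forces [vgap] = 1; both of its factors lie in [0, 1], so both must be 1. *)
Lemma orthogP n (x x' : 'cV[C]_n) (y y' : 'rV[C]_n) :
  unit_pair x y -> unit_pair x' y' ->
  orthog (x *m y) (x' *m y') <-> x^H *m x' = 0 /\ y *m y'^H = 0.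
Proof.
move=> ux ux'; have [h1 h2] := vgap_factors ux ux'.
rewrite /orthog (tn_pairD ux ux') (tn_pairB ux ux') /vgap.
have z0 (z : 'M[C]_1) : z = 0 <-> sqn (z 0 0) = 0.
  split=> [->|/eqP]; first by rewrite mxE /sqn /= expr0n addr0.
  by rewrite sqn_eq0 => /eqP z0; apply/matrixP => i j; rewrite !ord1 z0 mxE.
rewrite !z0; have := sqn_ge0 ((x^H *m x') 0 0); have := sqn_ge0 ((y *m y'^H) 0 0).
move: h1 h2; move: (sqn _) (sqn _) => q p p1 q1 q0 p0; split=> [E|[-> ->]].
  move: E; set s := Num.sqrt _ => E; have E1 : s = 1 by lra.
  have : (1 - p) * (1 - q) = 1.
    by rewrite -[LHS]sqr_sqrtr -/s ?E1 ?expr1n // mulr_ge0 // subr_ge0.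
  have hp : 0 <= q * (1 - p) by rewrite mulr_ge0 // subr_ge0.
  have hq : 0 <= p * (1 - q) by rewrite mulr_ge0 // subr_ge0.
  by move=> h; split; lra.
by rewrite !subr0 mulr1 sqrtr1; lra.
Qed.

Lemma unit_pair_delta n (i j : 'I_n) (w : C) : sqn w = 1 ->
  unit_pair (w *: delta_mx i 0 : 'cV[C]_n) (delta_mx 0 j).
Proof.
move=> w1; split; rewrite ?adjmxZ adj_delta -?scalemxAl -?scalemxAr mul_delta_mx.
  by rewrite scalerA mulrC unimodJ // scale1r; apply/matrixP => k l; rewrite !ord1 !mxE.
by apply/matrixP => k l; rewrite !ord1 !mxE.
Qed.

Lemma deltaE n (i j : 'I_n) (w : C) :
  w *: delta_mx i j = (w *: delta_mx i 0 : 'cV[C]_n) *m (delta_mx 0 j : 'rV[C]_n).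
Proof. by rewrite -scalemxAl mul_delta_mx. Qed.

Lemma rank1_delta n (i j : 'I_n) (w : C) : sqn w = 1 -> rank1 (w *: delta_mx i j).
Proof. by move=> w1; rewrite deltaE; apply: (rank1I i); apply: unit_pair_delta. Qed.

Lemma adjacent_delta n (i j : 'I_n) (w : C) (x : 'cV[C]_n) (y : 'rV[C]_n) :
  sqn w = 1 -> unit_pair x y ->
  adjacent (x *m y) (w *: delta_mx i j) <-> sqn (x i 0) = 1 \/ sqn (y 0 j) = 1.
Proof.
move=> w1 ux; rewrite deltaE (adjacentP ux (unit_pair_delta i j w1)).
rewrite -scalemxAr adj_delta -!colE !mxE adjmxE sqnM w1 mul1r sqnJ.
by [].
Qed.

Lemma adjacent_deltas n (i j k l : 'I_n) (w z : C) : sqn w = 1 -> sqn z = 1 ->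
  adjacent (w *: delta_mx i j) (z *: delta_mx k l) <-> i = k \/ j = l.
Proof.
move=> w1 z1; rewrite [w *: _]deltaE (adjacent_delta _ _ z1 (unit_pair_delta i j w1)).
rewrite !mxE sqnM w1 mul1r !eqxx andbT eq_sym [l == j]eq_sym /=.
have b1 (b : bool) : sqn (b%:R : C) = 1 <-> b.
  by case: b; rewrite /sqn /= ?expr1n ?expr0n ?addr0 //; split=> // /eqP; rewrite eq_sym oner_eq0.
by rewrite !b1; split=> -[/eqP|/eqP]; auto.
Qed.

Lemma unit_entry_col n (x : 'cV[C]_n) i : x^H *m x = 1%:M -> sqn (x i 0) = 1 ->
  x = x i 0 *: delta_mx i 0.
Proof.
move=> xx x1; have := @cauchy_sqn n (x^H) (delta_mx 0 i).
have -> : (x^H *m (delta_mx 0 i : 'rV[C]_n)^H) 0 0 = (x i 0)^*.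
  by rewrite adj_delta -colE mxE adjmxE.
rewrite adjmxK sqnJ adj_delta => -[] //.
  by rewrite mul_delta_mx; apply/matrixP => k l; rewrite !ord1 !mxE.
move=> _ /(_ x1) E; rewrite -[LHS]adjmxK E adjmxZ adj_delta.
by rewrite conjCK.
Qed.

Lemma unit_entry_row n (y : 'rV[C]_n) j : y *m y^H = 1%:M -> sqn (y 0 j) = 1 ->
  y = y 0 j *: delta_mx 0 j.
Proof.
move=> yy y1; have := @cauchy_sqn n y (delta_mx 0 j).
have -> : (y *m (delta_mx 0 j : 'rV[C]_n)^H) 0 0 = y 0 j by rewrite adj_delta -colE mxE.
rewrite adj_delta => -[] //.
  by rewrite mul_delta_mx; apply/matrixP => k l; rewrite !ord1 !mxE.
by move=> _ /(_ y1).
Qed.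

Lemma unit_pair_entries n (x : 'cV[C]_n) (y : 'rV[C]_n) i j : unit_pair x y ->
  sqn (x i 0) = 1 -> sqn (y 0 j) = 1 ->
  exists2 w : C, sqn w = 1 & x *m y = w *: delta_mx i j.
Proof.
case=> xx yy x1 y1; exists (x i 0 * y 0 j); first by rewrite sqnM x1 y1 mulr1.
rewrite {1}(unit_entry_col xx x1) {1}(unit_entry_row yy y1).
by rewrite -scalemxAl -scalemxAr mul_delta_mx scalerA.
Qed.

Lemma unit_entry_other n (x : 'cV[C]_n) i k : x^H *m x = 1%:M -> sqn (x i 0) = 1 ->
  k != i -> sqn (x k 0) = 1 -> False.
Proof.
move=> xx x1 ki; rewrite (unit_entry_col xx x1) !mxE (negPf ki) mulr0.
by move=> /eqP; rewrite /sqn /= expr0n addr0 eq_sym oner_eq0.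
Qed.

Lemma unit_entry_other_row n (y : 'rV[C]_n) i k : y *m y^H = 1%:M -> sqn (y 0 i) = 1 ->
  k != i -> sqn (y 0 k) = 1 -> False.
Proof.
move=> yy y1 ki; rewrite (unit_entry_row yy y1) !mxE (negPf ki) mulr0.
by move=> /eqP; rewrite /sqn /= expr0n addr0 eq_sym oner_eq0.
Qed.

(** * Isometries of the set of rank-one elements *)

(** Norms of sums are included because f commutes with negation on rank-one elements; [rip],
    [adjacent] and [orthog] depend on both norms. *)
Definition rank1_isometry n (F : 'M[C]_n -> 'M[C]_n) :=
  (forall a, rank1 a -> rank1 (F a)) /\
  forall a b, rank1 a -> rank1 b ->
    tn (F a + F b) = tn (a + b) /\ tn (F a - F b) = tn (a - b).

(** The four forms (a) to (d), required on [P] only: first on the rank-one elements, then on the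
    whole sphere. *)
Definition standard_on (P : forall n, 'M[C]_n -> Prop) n (F : 'M[C]_n -> 'M[C]_n) :=
  exists u v : 'M[C]_n, [/\ unitary u, unitary v &
   [\/ forall a, P n a -> F a = u *m a *m v,
       forall a, P n a -> F a = u *m a^T *m v,
       forall a, P n a -> F a = u *m map_mx Num.conj a *m v
     | forall a, P n a -> F a = u *m a^H *m v]].

Lemma adjmxT n (a : 'M[C]_n) : (a^H)^T = map_mx Num.conj a.
Proof. by apply/matrixP => i j; rewrite !mxE adjmxE. Qed.

Lemma conjmxT n (a : 'M[C]_n) : (map_mx Num.conj a)^T = a^H.
Proof. by apply/matrixP => i j; rewrite !mxE adjmxE. Qed.

Lemma rank1_unitary n (u v a : 'M[C]_n) : unitary u -> unitary v -> rank1 a ->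
  rank1 (u *m a *m v).
Proof.
move=> uU vU [u' [v' [i [u'U v'U ->]]]]; exists (u *m u'), (v' *m v), i.
split; [exact: unitaryM | exact: unitaryM | by rewrite !mulmxA].
Qed.

Lemma rank1T n (a : 'M[C]_n) : rank1 a -> rank1 (a^T).
Proof.
move=> [u [v [i [uU vU ->]]]]; exists (v^T), (u^T), i.
split; [exact: unitaryT | exact: unitaryT |].
by rewrite !trmx_mul trmx_delta mulmxA.
Qed.

Lemma rank1J n (a : 'M[C]_n) : rank1 a -> rank1 (a^H).
Proof.
move=> [u [v [i [uU vU ->]]]]; exists (v^H), (u^H), i.
split; [exact: unitary_adj | exact: unitary_adj |].
by rewrite !adjmxM adj_delta mulmxA.
Qed.

Lemma standard_unitary n (u v : 'M[C]_n) (P : forall n, 'M[C]_n -> Prop) F :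
  unitary u -> unitary v ->
  standard_on P (fun a => u^H *m F a *m v^H) -> standard_on P F.
Proof.
move=> uU vU [u' [v' [u'U v'U h]]]; exists (u *m u'), (v' *m v).
have E x y : u^H *m x *m v^H = u' *m y *m v' -> x = u *m u' *m y *m (v' *m v).
  move=> /(congr1 (fun z => u *m z *m v)).
  rewrite !mulmxA (unitaryP uU) mul1mx -!mulmxA (unitary_adjK vU) mulmx1.
  by move=> ->.
split; [exact: unitaryM | exact: unitaryM |].
by case: h => h; [constructor 1 | constructor 2 | constructor 3 | constructor 4]
  => a Pa; apply: E; apply: h.
Qed.

Lemma standardT n (P : forall n, 'M[C]_n -> Prop) (F : 'M[C]_n -> 'M[C]_n) :
  standard_on P (fun a => (F a)^T) -> standard_on P F.
Proof.
move=> [u [v [uU vU h]]]; exists (v^T), (u^T).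
split; [exact: unitaryT | exact: unitaryT |].
have E x y : x^T = u *m y *m v -> x = v^T *m y^T *m u^T.
  by move=> /(congr1 trmx); rewrite trmxK !trmx_mul mulmxA.
case: h => h; [constructor 2 | constructor 1 | constructor 4 | constructor 3]
  => a Pa; rewrite (E _ _ (h a Pa)) ?trmxK ?adjmxT ?conjmxT //.
Qed.

Lemma isometry_unitary n (u v : 'M[C]_n) F : unitary u -> unitary v ->
  rank1_isometry F -> rank1_isometry (fun a => u *m F a *m v).
Proof.
move=> uU vU [F1 F2]; split=> [a ra|a b ra rb]; first by apply: rank1_unitary (F1 a ra).
have [hD hB] := F2 a b ra rb.
have tE x : tn (u *m x *m v) = tn x by rewrite (tnMr _ vU) (tnMl _ uU).
by rewrite -hD -hB -(tE (F a + F b)) -(tE (F a - F b)) mulmxDr mulmxDl mulmxBr mulmxBl.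
Qed.

Lemma isometryT n (F : 'M[C]_n -> 'M[C]_n) :
  rank1_isometry F -> rank1_isometry (fun a => (F a)^T).
Proof.
move=> [F1 F2]; split=> [a ra|a b ra rb]; first exact/rank1T/F1.
by have [hD hB] := F2 a b ra rb; rewrite -!linearD -linearB /= !tnT.
Qed.

Lemma rank1_delta1 n (i j : 'I_n) : rank1 (delta_mx i j : 'M[C]_n).
Proof. by rewrite -[delta_mx i j]scale1r; apply/rank1_delta/sqn1. Qed.

Lemma adjacent_deltas1 n (i j k l : 'I_n) :
  adjacent (delta_mx i j : 'M[C]_n) (delta_mx k l) <-> i = k \/ j = l.
Proof.
rewrite -[delta_mx i j]scale1r -[delta_mx k l]scale1r.
by apply: adjacent_deltas; exact: sqn1.
Qed.

Lemma orthog_deltas n (i j k l : 'I_n) : i != k -> j != l ->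
  orthog (delta_mx i j : 'M[C]_n) (delta_mx k l).
Proof.
move=> ik jl; rewrite -[delta_mx i j]scale1r -[delta_mx k l]scale1r !deltaE.
apply: (proj2 (orthogP (unit_pair_delta i j sqn1) (unit_pair_delta k l sqn1))).
by rewrite !scale1r !adj_delta !mul_delta_mx_0.
Qed.

(** * Images of the matrix units *)

Definition straight n (F : 'M[C]_n -> 'M[C]_n) i j :=
  exists2 w : C, sqn w = 1 & F (delta_mx i j) = w *: delta_mx i j.
Definition swapped n (F : 'M[C]_n -> 'M[C]_n) i j :=
  exists2 w : C, sqn w = 1 & F (delta_mx i j) = w *: delta_mx j i.

Section Rank1Isometry.
Variables (n : nat) (F : 'M[C]_n -> 'M[C]_n).
Hypothesis FI : rank1_isometry F.

Lemma adjacent_iso a b : rank1 a -> rank1 b -> adjacent (F a) (F b) <-> adjacent a b.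
Proof. by move=> ra rb; have [E1 E2] := FI.2 a b ra rb; rewrite /adjacent E1 E2. Qed.

Lemma orthog_iso a b : rank1 a -> rank1 b -> orthog (F a) (F b) <-> orthog a b.
Proof. by move=> ra rb; have [E1 E2] := FI.2 a b ra rb; rewrite /orthog E1 E2. Qed.

Lemma rip_iso a b : rank1 a -> rank1 b -> rip (F a) (F b) = rip a b.
Proof.
move=> ra rb; have [E1 E2] := FI.2 a b ra rb.
have := tn_rip (FI.1 a ra) (FI.1 b rb); rewrite E1 E2 -tn_rip //.
by apply: mulfI; rewrite pnatr_eq0.
Qed.

(** The images of the e_kk are pairwise orthogonal, so their column vectors and their row vectors
    form orthonormal bases. *)
Lemma diagonal_frame : exists (u v : 'M[C]_n), [/\ unitary u, unitary v &
  forall k, F (delta_mx k k) = u *m delta_mx k k *m v].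
Proof.
have /choice [xy Hxy] : forall k, exists xy : 'cV[C]_n * 'rV[C]_n,
    unit_pair xy.1 xy.2 /\ F (delta_mx k k) = xy.1 *m xy.2.
  move=> k; have [x [y [ux ->]]] := rank1_vec (FI.1 _ (rank1_delta1 k k)).
  by exists (x, y).
pose x k := (xy k).1; pose y k := (xy k).2.
have ux k : unit_pair (x k) (y k) := (Hxy k).1.
have Fk k : F (delta_mx k k) = x k *m y k := (Hxy k).2.
have o k l : k != l -> (x k)^H *m x l = 0 /\ y k *m (y l)^H = 0.
  move=> kl; apply/(orthogP (ux k) (ux l)); rewrite -!Fk orthog_iso; try exact: rank1_delta1.
  exact: orthog_deltas.
have xo k l : ((x k)^H *m x l) 0 0 = (k == l)%:R.
  by case: eqVneq => [<-|/o[-> _]]; rewrite ?(ux k).1 mxE.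
have yo k l : (y k *m (y l)^H) 0 0 = (k == l)%:R.
  by case: eqVneq => [<-|/o[_ ->]]; rewrite ?(ux k).2 mxE.
pose u : 'M[C]_n := \matrix_(i, k) x k i 0.
pose v : 'M[C]_n := \matrix_(k, j) y k 0 j.
have uU : unitary u.
  split; apply: mulmx1C; apply/matrixP => k l; rewrite [RHS]mxE -xo !mxE.
  by apply: eq_bigr => i _; rewrite !(adjmxE, mxE).
have vU : unitary v.
  split; apply/matrixP => k l; rewrite [RHS]mxE -yo !mxE.
  by apply: eq_bigr => i _; rewrite !(adjmxE, mxE).
exists u, v; split=> // k.
rewrite Fk -(mul_delta_mx (0 : 'I_1)) mulmxA -mulmxA; congr (_ *m _).
  by rewrite -colE; apply/colP => i; rewrite !mxE.
by rewrite -rowE; apply/rowP => j; rewrite !mxE.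
Qed.

Section DiagonalFixed.
Hypothesis Fdiag : forall k, F (delta_mx k k) = delta_mx k k.

(** e_ij is adjacent to e_ii and to e_jj, so in its image one of the two vectors lies on axis i and
    one on axis j; a single vector cannot lie on both. *)
Lemma straight_or_swapped i j : i != j -> straight F i j \/ swapped F i j.
Proof.
move=> ij; have [x [y [ux Fx]]] := rank1_vec (FI.1 _ (rank1_delta1 i j)).
have A k : k = i \/ k = j -> sqn (x k 0) = 1 \/ sqn (y 0 k) = 1.
  move=> kij; rewrite -(adjacent_delta k k sqn1 ux) scale1r -Fx -[delta_mx k k]Fdiag.
  rewrite adjacent_iso ?adjacent_deltas1; try exact: rank1_delta1.
  by case: kij => ->; auto.
have [xi|yi] := A i (or_introl erefl); have [xj|yj] := A j (or_intror erefl).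
- by case: (unit_entry_other ux.1 xj ij xi).
- left; have [w w1 Ew] := unit_pair_entries ux xi yj.
  by exists w => //; rewrite Fx Ew.
- right; have [w w1 Ew] := unit_pair_entries ux xj yi.
  by exists w => //; rewrite Fx Ew.
- by case: (unit_entry_other_row ux.2 yj ij yi).
Qed.

(** e_ij and e_kl are adjacent, whereas e_ij and e_lk could then be adjacent only if i = j or k =
    l. *)
Lemma straight_spread i j k l : i != j -> straight F i j -> k != l ->
  (i = k \/ j = l) -> straight F k l.
Proof.
move=> ij [w w1 Ew] kl h; have [//|[z z1 Ez]] := straight_or_swapped kl.
have : adjacent (F (delta_mx i j)) (F (delta_mx k l)).
  by rewrite adjacent_iso ?adjacent_deltas1; try exact: rank1_delta1.
rewrite Ew Ez adjacent_deltas // => h'.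
by case: h => ?; case: h' => ?; subst; move: ij kl; rewrite ?eqxx.
Qed.

(** Otherwise the images of e_ij and e_ji would both be multiples of e_ij, hence adjacent, which
    e_ij and e_ji are not. *)
Lemma straight_swap i j : i != j -> straight F i j -> straight F j i.
Proof.
move=> ij [w w1 Ew]; have ji : j != i by rewrite eq_sym.
have [//|[z z1 Ez]] := straight_or_swapped ji.
have : adjacent (F (delta_mx i j)) (F (delta_mx j i)).
  by rewrite Ew Ez adjacent_deltas //; left.
rewrite adjacent_iso ?adjacent_deltas1; try exact: rank1_delta1.
move=> -[] e.
  by move: ij; rewrite e eqxx.
by move: ij; rewrite e eqxx.
Qed.

Lemma straight_all i j : i != j -> straight F i j -> forall k l, k != l -> straight F k l.
Proof.
(* The route is (i, j), (i, l), (k, l); it would pass through the diagonal when l = i, where (j, i)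
   replaces (i, l). *)
move=> ij sij k l kl; have [li|li] := eqVneq l i.
  rewrite -li in ij sij *; apply: (@straight_spread j l) => //.
  - by rewrite eq_sym.
  - exact: straight_swap.
  - by right.
have sil : straight F i l by apply: (straight_spread ij sij); rewrite 1?eq_sym //; left.
by apply: (straight_spread _ sil) => //; [rewrite eq_sym | right].
Qed.

End DiagonalFixed.
End Rank1Isometry.

(** * Phases and conjugation of the entries *)

Definition conj_if (s : bool) (z : C) : C := if s then z^* else z.

Lemma conj_ifM s z w : conj_if s (z * w) = conj_if s z * conj_if s w.
Proof. by case: s => //=; rewrite rmorphM. Qed.

Lemma conj_if1 s : conj_if s 1 = 1.
Proof. by case: s => //=; rewrite conjC1. Qed.

Lemma conj_if_real s (r : R) : conj_if s r%:C = r%:C.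
Proof. by case: s => //=; rewrite conj_real. Qed.

Definition imag : C := Complex 0 1.

Lemma sqn_imag : sqn imag = 1.
Proof. by rewrite /sqn /= expr1n expr0n add0r. Qed.

Lemma imag_neqN : imag <> - imag.
Proof. by move=> /(congr1 (@complex.Im R)) /= h; lra. Qed.

Lemma conj_if_inj s t : conj_if s imag = conj_if t imag -> s = t.
Proof.
have E : imag^* = - imag by apply/eqP; rewrite eq_complex /= oppr0 !eqxx.
by case: s t => -[] //=; rewrite E => /= h; case: imag_neqN.
Qed.

Lemma rip_delta n (a : 'M[C]_n) (w : C) i j :
  rip a (w *: delta_mx i j) = re (a i j * w^*).
Proof.
rewrite /rip adjmxZ adj_delta -scalemxAr /rtr mxtraceZ mulrC; congr (re (_ * _)).
rewrite /mxtrace (bigD1 i) //= big1 ?addr0.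
  rewrite mxE (bigD1 j) //= big1 ?addr0 ?mxE ?eqxx ?mulr1 //.
  by move=> k kj; rewrite mxE (negPf kj) mulr0.
move=> k ki; rewrite mxE big1 // => l _.
by rewrite mxE (negPf ki) andbF mulr0.
Qed.

Lemma rip_delta1 n (a : 'M[C]_n) i j : rip a (delta_mx i j) = re (a i j).
Proof. by rewrite -[delta_mx i j]scale1r rip_delta conjC1 mulr1. Qed.

Lemma rank1_minor n (a : 'M[C]_n) i j k l : rank1 a -> a i j * a k l = a i l * a k j.
Proof.
move=> /rank1_vec [x [y [_ ->]]].
by rewrite !mxE !big_ord_recl !big_ord0 !addr0; ring.
Qed.

(** Rank-one test elements without zero entries, so that each 2 x 2 minor of the image relates four
    phases; the factor 1/n makes the norm 1. *)
Definition phases n (z w : 'I_n -> C) : 'M[C]_n :=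
  \matrix_(i, j) ((n%:R^-1)%:C * (z i * w j)).

Lemma rank1_phases n (z w : 'I_n -> C) : (0 < n)%N ->
  (forall i, sqn (z i) = 1) -> (forall i, sqn (w i) = 1) -> rank1 (phases z w).
Proof.
move=> n0 z1 w1; have nn : (n%:R : R) != 0 by rewrite pnatr_eq0 -lt0n.
pose c : R := Num.sqrt n%:R^-1.
have cc : c * c = n%:R^-1 by rewrite -expr2 sqr_sqrtr // invr_ge0 ler0n.
pose x : 'cV[C]_n := \col_i (c%:C * z i); pose y : 'rV[C]_n := \row_i (c%:C * w i).
have -> : phases z w = x *m y.
  apply/matrixP => i j; rewrite !mxE !big_ord_recl big_ord0 addr0 !mxE -cc rmorphM.
  by rewrite /=; ring.
have sum1 (t : 'I_n -> C) : (forall i, sqn (t i) = 1) ->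
    \sum_i (c%:C * t i) * (c%:C * t i)^* = 1.
  move=> t1; under eq_bigr => i _ do rewrite sqnE sqnM t1 mulr1.
  rewrite realC_sum sumr_const card_ord /sqn /= expr0n addr0 expr2 cc.
  by rewrite -(mulr_natr n%:R^-1) mulVf.
apply: (rank1I (Ordinal n0)); split; apply/matrixP => i j; rewrite !ord1 !mxE eqxx.
  by rewrite -[RHS](sum1 z) //; apply: eq_bigr => k _; rewrite adjmxE !mxE mulrC.
by rewrite -[RHS](sum1 w) //; apply: eq_bigr => k _; rewrite adjmxE !mxE.
Qed.

Lemma unimod_re0 (q : C) : sqn q = 1 -> re q = 0 -> q = imag \/ q = - imag.
Proof.
case: q => a b; rewrite /sqn /= => h a0; rewrite a0 in h *.
have : (b - 1) * (b + 1) = 0 by lra.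
move/eqP; rewrite mulf_eq0 subr_eq0 addr_eq0 => /orP[] /eqP ->; [left | right] => //.
by apply/eqP; rewrite eq_complex /= oppr0 !eqxx.
Qed.

Section Straight.
Variables (n : nat) (F : 'M[C]_n -> 'M[C]_n).
Hypothesis FI : rank1_isometry F.
Hypothesis Fstr : forall i j, straight F i j.

(** i e_ij is adjacent to all matrix units in row i and in column j, which [F] fixes up to
    phases. *)
Lemma image_imag i j : exists2 w : C, sqn w = 1 & F (imag *: delta_mx i j) = w *: delta_mx i j.
Proof.
have ri := rank1_delta i j sqn_imag.
have [x [y [ux Fx]]] := rank1_vec (FI.1 _ ri).
have A k l : k = i \/ l = j -> sqn (x k 0) = 1 \/ sqn (y 0 l) = 1.
  move=> h; have [w w1 Ew] := Fstr k l.
  rewrite -(adjacent_delta k l w1 ux) -Ew -Fx (adjacent_iso FI) //; last exact: rank1_delta1.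
  rewrite -[delta_mx k l]scale1r (adjacent_deltas _ _ _ _ sqn_imag sqn1).
  by case: h => ->; auto.
suff [x1 y1] : sqn (x i 0) = 1 /\ sqn (y 0 j) = 1.
  by have [w w1 Ew] := unit_pair_entries ux x1 y1; exists w => //; rewrite Fx Ew.
case: ux => xx yy.
(* Once one vector lies on its axis, a matrix unit off that axis forces the other vector. If there
   is none, the dimension is one and every unit vector lies on the axis. *)
have [x1|y1] := A i j (or_introl erefl).
  split=> //; case: (pickP (fun k => k != i)) => [k ki|allk].
    by have [/(unit_entry_other xx x1 ki)//|] := A k j (or_intror erefl).
  have := congr1 (fun M : 'M[C]_1 => re (M 0 0)) yy; rewrite /= !mxE (bigD1 j) //= big1.
    by rewrite addr0 adjmxE sqnE.
  by move=> k kj; have := allk k; have := allk j => /negbFE/eqP ji /negbFE/eqP ki;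
      rewrite ki ji eqxx in kj.
split=> //; case: (pickP (fun k => k != j)) => [k kj|allk].
  by have [|/(unit_entry_other_row yy y1 kj)//] := A i k (or_introl erefl).
have := congr1 (fun M : 'M[C]_1 => re (M 0 0)) xx; rewrite /= !mxE (bigD1 i) //= big1.
  by rewrite addr0 adjmxE mulrC sqnE.
by move=> k ki; have := allk k; have := allk i => /negbFE/eqP ij /negbFE/eqP kj;
    rewrite kj ij eqxx in ki.
Qed.

(** Pairing with e_ij and i e_ij gives the real coordinates of the entry. Their images w e_ij and z
    e_ij are orthogonal for [rip], so z is i w or - i w; the second case is conjugation. *)
Lemma entry_form i j : exists (w : C) (s : bool), sqn w = 1 /\
  forall a, rank1 a -> F a i j = w * conj_if s (a i j).
Proof.
have [w w1 Ew] := Fstr i j; have [z z1 Ez] := image_imag i j.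
have ri := rank1_delta i j sqn_imag; have r1 := rank1_delta1 i j.
have q1 : sqn (z * w^*) = 1 by rewrite sqnM sqnJ z1 w1 mulr1.
have qre : re (z * w^*) = 0.
  have := rip_iso FI ri r1; rewrite Ew Ez rip_delta1 rip_delta.
  by rewrite !mxE !eqxx !mulr1.
have zq : z = (z * w^*) * w by rewrite -mulrA [w^* * _]mulrC unimodJ // mulr1.
exists w, (z * w^* == - imag); split=> // a ra.
set p := F a i j * w^*.
have -> : F a i j = w * p by rewrite /p mulrCA unimodJ // mulr1.
congr (w * _).
have Hre : re p = re (a i j).
  have := rip_iso FI ra r1; by rewrite Ew rip_delta1 rip_delta.
have Him : re (p * (z * w^*)^*) = complex.Im (a i j).
  have E := rip_iso FI ra ri; rewrite Ez {1}zq !rip_delta in E.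
  transitivity (re (a i j * imag^*)); last by case: (a i j) => b c /=; ring.
  by rewrite -E; congr re; rewrite [in RHS]rmorphM /= /p; ring.
move: Hre Him; case: (unimod_re0 q1 qre) => ->.
  have -> : (imag == - imag) = false.
    by apply/eqP/imag_neqN.
  case: p (a i j) => b c [b' c'] /= -> h; apply/eqP; rewrite eq_complex /= eqxx /=.
  by apply/eqP; lra.
rewrite eqxx; case: p (a i j) => b c [b' c'] /= -> h; apply/eqP; rewrite eq_complex /= eqxx /=.
by apply/eqP; lra.
Qed.

End Straight.

Lemma diag_unitary n (d : 'I_n -> C) : (forall i, sqn (d i) = 1) ->
  unitary (diag_mx (\row_i d i)).
Proof.
move=> d1; split; apply/matrixP => i j.
rewrite mul_diag_mx mxE adjmxE !mxE eq_sym; case: eqVneq => [->|_]; last by rewrite conjC0 mulr0.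
by rewrite mulr1n unimodJ.
Qed.

Lemma straight_standard n (F : 'M[C]_n -> 'M[C]_n) : (0 < n)%N -> rank1_isometry F ->
  (forall i j, straight F i j) -> standard_on (@rank1) F.
Proof.
move=> n0 FI Fs; pose o := Ordinal n0.
have /choice [p Hp] : forall ij : 'I_n * 'I_n, exists p : C * bool, sqn p.1 = 1 /\
    forall a, rank1 a -> F a ij.1 ij.2 = p.1 * conj_if p.2 (a ij.1 ij.2).
  by move=> [i j]; have [w [s H]] := entry_form FI Fs i j; exists (w, s).
pose om i j := (p (i, j)).1; pose s i j := (p (i, j)).2.
have om1 i j : sqn (om i j) = 1 := (Hp (i, j)).1.
have FE a i j : rank1 a -> F a i j = om i j * conj_if (s i j) (a i j) := (Hp (i, j)).2 a.
have nn : (n%:R^-1)%:C != 0 :> C.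
  by rewrite eq_complex /= eqxx andbT invr_eq0 pnatr_eq0 -lt0n.
have cancel (a a' b b' c c' d d' : C) :
    (a * ((n%:R^-1)%:C * a')) * (b * ((n%:R^-1)%:C * b')) =
    (c * ((n%:R^-1)%:C * c')) * (d * ((n%:R^-1)%:C * d')) ->
    (a * a') * (b * b') = (c * c') * (d * d').
  move: nn; move: (n%:R^-1)%:C => r r0 E; apply: (mulfI r0); apply: (mulfI r0).
  have -> : r * (r * (a * a' * (b * b'))) = a * (r * a') * (b * (r * b')) by ring.
  by rewrite E; ring.
(* The vanishing minors of the image of [phases z w], with the powers of 1/n cancelled. *)
have minor (z w : 'I_n -> C) i j k l :
    (forall i, sqn (z i) = 1) -> (forall i, sqn (w i) = 1) ->
    (om i j * conj_if (s i j) (z i * w j)) * (om k l * conj_if (s k l) (z k * w l)) =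
    (om i l * conj_if (s i l) (z i * w l)) * (om k j * conj_if (s k j) (z k * w j)).
  move=> z1 w1; have r := rank1_phases n0 z1 w1.
  have := rank1_minor i j k l (FI.1 _ r); rewrite !FE // !mxE.
  by rewrite ![conj_if _ ((n%:R^-1)%:C * _)]conj_ifM !conj_if_real => /cancel.
have one1 (i : 'I_n) : sqn (1 : C) = 1 := sqn1.
have omM i j k l : om i j * om k l = om i l * om k j.
  by have := minor (fun=> 1) (fun=> 1) i j k l one1 one1; rewrite !mulr1 !conj_if1 !mulr1.
(* Putting i into a single row or column makes the minor compare two conjugation flags, as [omM]
   removes the phases. *)
pose at_ (i k : 'I_n) : C := if k == i then imag else 1.
have at1 i k : sqn (at_ i k) = 1 by rewrite /at_; case: eqP => _; rewrite ?sqn_imag ?sqn1.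
have om0 i j : om i j != 0 by exact: unimod_neq0.
have sl i j l : s i j = s i l.
  have [<-//|jl] := eqVneq j l.
  have [k ki] : exists k, k != i.
    have [ji|ji] := eqVneq j i; last by exists j.
    by exists l; rewrite -ji eq_sym.
  apply: conj_if_inj; have := minor (at_ i) (fun=> 1) i j k l (at1 i) one1.
  rewrite !mulr1 /at_ eqxx (negPf ki) !conj_if1 !mulr1 mulrAC omM.
  by rewrite [RHS]mulrAC => /mulfI; apply; rewrite mulf_neq0.
have sr i j k : s i j = s k j.
  have [<-//|ik] := eqVneq i k.
  have [l lj] : exists l, l != j.
    have [ij|ij] := eqVneq i j; last by exists i.
    by exists k; rewrite -ij eq_sym.
  apply: conj_if_inj; have := minor (fun=> 1) (at_ j) i j k l one1 (at1 j).
  rewrite !mul1r /at_ eqxx (negPf lj) !conj_if1 !mulr1 mulrAC omM.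
  by rewrite mulrA => /mulfI; apply; rewrite mulf_neq0.
(* By [omM] the phases form a rank-one array, which splits into a row factor and a column factor
   normalized at (o, o). *)
pose u : 'M[C]_n := diag_mx (\row_i om i o).
pose v : 'M[C]_n := diag_mx (\row_j (om o j * (om o o)^*)).
exists u, v.
have uU : unitary u by apply: diag_unitary.
have vU : unitary v by apply: diag_unitary => j; rewrite sqnM sqnJ !om1 mulr1.
have E a i j : rank1 a -> F a i j = om i o * conj_if (s o o) (a i j) * (om o j * (om o o)^*).
  move=> ra; rewrite FE // (sl i j o) (sr i o o).
  have -> : om i j = om i o * om o j * (om o o)^*.
    by rewrite -omM -mulrA unimodJ // mulr1.
  by ring.
split=> //; case es : (s o o); [constructor 3 | constructor 1] => a ra;
  by apply/matrixP => i j; rewrite E // es mul_mx_diag mxE mul_diag_mx !mxE.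
Qed.

(** In the frames of [diagonal_frame], either all off-diagonal matrix units are straight, or one is
    swapped; in the latter case transposition makes it straight, and [straight_all] spreads this to
    the others. *)
Theorem rank1_isometry_standard n (F : 'M[C]_n -> 'M[C]_n) : (0 < n)%N ->
  rank1_isometry F -> standard_on (@rank1) F.
Proof.
move=> n0 FI; have [u [v [uU vU Fuv]]] := diagonal_frame FI.
apply: (standard_unitary uU vU).
pose G a := u^H *m F a *m v^H; rewrite -/G.
have GI : rank1_isometry G.
  by apply: isometry_unitary => //; apply: unitary_adj.
have Gd k : G (delta_mx k k) = delta_mx k k.
  rewrite /G Fuv !mulmxA (unitary_adjK uU) mul1mx -mulmxA (unitaryP vU) mulmx1.
  by [].
have diag (H : 'M[C]_n -> 'M[C]_n) : (forall k, H (delta_mx k k) = delta_mx k k) ->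
    (forall i j, i != j -> straight H i j) -> forall i j, straight H i j.
  move=> Hd Hs i j; have [->|/Hs//] := eqVneq i j.
  by exists 1; rewrite ?sqn1 // Hd scale1r.
have [allG|nallG] := EM (forall i j, i != j -> straight G i j).
  by apply: straight_standard => //; apply: diag.
have [i [j [ij nij]]] : exists i j, i != j /\ ~ straight G i j.
  apply: contrapT => h; apply: nallG => i j ij; apply: contrapT => nij.
  by apply: h; exists i, j.
apply: standardT; have TI := isometryT GI.
have Td k : (G (delta_mx k k))^T = delta_mx k k by rewrite Gd trmx_delta.
apply: straight_standard => //; apply: diag => //.
apply: (straight_all TI Td ij).
have [//|[w w1 Ew]] := straight_or_swapped GI Gd ij.
by exists w => //; rewrite Ew linearZ /= trmx_delta.
Qed.

(** * Distances to the rank-one elements *)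

(** For x = u D v the product c x is v^H D v, the modulus of x. *)
Lemma norming_hermitian n (c x : 'M[C]_n) : norming c x -> (c *m x)^H = c *m x.
Proof.
have [u [v [d [uU vU d0 ->]]]] := svd x; move=> cx; have cU := proj1 cx.
move: cx; rewrite norming_svd // => E.
have wU : unitary (v *m c *m u) by exact: unitaryM (unitaryM vU cU) uU.
have E' : (v *m c *m u) *m rdiag d = rdiag d.
  have /(congr1 (@adjmx R n n)) := E; rewrite adjmxM adj_rdiag => {1}<-.
  by rewrite mulmxA (unitaryP wU) mul1mx.
have -> : c *m (u *m rdiag d *m v) = v^H *m rdiag d *m v.
  by rewrite -{2}E' !mulmxA (unitary_adjK vU) mul1mx.
by rewrite !adjmxM adjmxK adj_rdiag mulmxA.
Qed.

Lemma rtr_delta_mul n (i : 'I_n) (y : 'M[C]_n) : rtr (delta_mx i i *m y) = re (y i i).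
Proof.
rewrite rtrC -[y in LHS]/(y) -(adj_delta _ i i) -/(rip _ _) rip_delta1 //.
Qed.

(** The diagonal entries of a unitary have real parts in [-1, 1], so testing gives at most (1 - d_i)
    plus the sum of the other d_j, which is again 1 - d_i. *)
Lemma tn_rdiag_sub n (d : 'I_n -> R) i : (forall j, 0 <= d j) -> \sum_j d j = 1 ->
  tn (rdiag d - delta_mx i i) <= 2 - 2 * d i.
Proof.
move=> d0 sd; have [c cU <-] := tn_attained (rdiag d - delta_mx i i).
rewrite mulmxBr rtrB rtr_rdiag [X in _ - X]rtrC rtr_delta_mul.
have crj j : re (c j j) <= 1 by exact: unitary_re_le.
have ci : - 1 <= re (c i i).
  by have := unitary_re_le i i (unitaryN cU); rewrite mxE raddfN /=; lra.
rewrite (bigD1 i) //= in sd; rewrite (bigD1 i) //=.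
have S : \sum_(j < n | j != i) re (c j j) * d j <= \sum_(j < n | j != i) d j.
  by apply: ler_sum => j _; rewrite ler_piMl.
have Sd : 0 <= \sum_(j < n | j != i) d j by apply: sumr_ge0.
have : (1 - d i) * (- 1) <= (1 - d i) * re (c i i) by apply: ler_wpM2l => //; lra.
by lra.
Qed.

Lemma rdiag_determined n (d : 'I_n -> R) (y : 'M[C]_n) :
  (forall j, 0 <= d j) -> \sum_j d j = 1 -> tn y = 1 ->
  (forall a, rank1 a -> tn (y - a) = tn (rdiag d - a)) -> y = rdiag d.
Proof.
move=> d0 sd y1 h.
have tdg (e : 'I_n -> R) : rtr (rdiag e) = \sum_i e i.
  by rewrite -[rdiag e]mul1mx rtr_rdiag; apply: eq_bigr => i _; rewrite mxE eqxx mul1r.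
have nd : tn (rdiag d) = 1.
  by rewrite -[rdiag d]mul1mx -[_ *m _]mulmx1 tn_svd //; exact: unitary1.
have [p [q [m [pU qU m0 Ey]]]] := svd y.
have sm : \sum_i m i = 1 by rewrite -(tn_svd pU qU m0) -Ey.
(* The identity norms both [rdiag d] and the projection q^H e_ii q, so their sum has norm 2; by
   hypothesis the same holds with [y] in place of [rdiag d]. *)
have comp i : m i != 0 -> p *m delta_mx i i = q^H *m delta_mx i i.
  move=> mi; have qHU := unitary_adj qU.
  have ra : rank1 (q^H *m delta_mx i i *m q) by exists (q^H), q, i.
  have : tn (y + q^H *m delta_mx i i *m q) = 2.
    rewrite -[X in y + X]opprK h ?opprK; last exact: rank1N.
    rewrite near_norming ?(tn_rank1 ra) //; exists 1%:M; rewrite /norming !mul1mx.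
    split; (split; first exact: unitary1); first by rewrite nd tdg.
    rewrite (tn_rank1 ra) rtrC mulmxA (unitaryP qU) mul1mx delta_rdiag tdg.
    by rewrite (bigD1 i) //= eqxx big1 ?addr0 // => j /negPf ->.
  rewrite near_norming ?(tn_rank1 ra) // => -[c [cy ca]]; have cU := proj1 cy.
  move: ca; rewrite norming_rank1 // => ca.
  rewrite Ey in cy; have := norming_component pU qU m0 mi cy.
  rewrite norming_rank1 // => cb.
  have E1 : delta_mx i i *m (q *m c) = delta_mx i i *m q.
    by move/(congr1 (fun z => z *m q)): ca; rewrite -!mulmxA (unitary_adjK qU) mulmx1.
  have E2 : delta_mx i i *m q = delta_mx i i *m p^H.
    move/(congr1 (fun z => z *m p^H)): cb.
    by rewrite mulmxA E1 -!mulmxA (unitaryP pU) mulmx1.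
  by have := congr1 (@adjmx R n n) E2; rewrite !adjmxM adj_delta adjmxK => ->.
(* [y] is positive: any unitary norming both [y] and [q_i^H q_i] fixes [q_i]. *)
have {}Ey : y = q^H *m rdiag m *m q.
  rewrite Ey; congr (_ *m _); rewrite rdiag_sum !mulmx_sumr; apply: eq_bigr => i _.
  rewrite -!scalemxAr; have [->|mi] := eqVneq (m i) 0; first by rewrite !scale0r.
  by rewrite comp.
have yH : y^H = y by rewrite Ey !adjmxM adjmxK adj_rdiag mulmxA.
have ty : rtr y = 1 by rewrite Ey rtrC mulmxA (unitaryP qU) mul1mx tdg.
have cr i : rtr (refl_mx i *m (y - delta_mx i i)) = 2 - 2 * re (y i i).
  have d1 : rtr (delta_mx i i : 'M[C]_n) = 1.
    by rewrite -[delta_mx i i]mulmx1 rtr_delta_mul mxE eqxx.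
  have two : 2 = (2 : R)%:C :> C by rewrite rmorph_nat.
  rewrite /refl_mx two mulmxBl mul1mx -scalemxAl rtrB rtrZ mulmxBr mul_delta_mx !rtrB.
  by rewrite ty rtr_delta_mul d1; ring.
(* Testing [y - e_ii] against [refl_mx i] gives [d i <= y i i]; both sides sum to 1. *)
have ge i : d i <= re (y i i).
  have := tn_ge (y - delta_mx i i) (refl_mx_unitary i); rewrite cr.
  rewrite h; last exact: rank1_delta1.
  by have := tn_rdiag_sub i d0 sd; lra.
have eqd i : re (y i i) = d i.
  apply/eqP; rewrite -subr_eq0.
  have : \sum_i (re (y i i) - d i) = 0.
    by rewrite sumrB sd -ty /rtr /mxtrace re_sum subrr.
  move/eqP; rewrite psumr_eq0; last by move=> j _; rewrite subr_ge0.
  by move=> /allP/(_ i (mem_index_enum _)).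
(* Equality of the diagonals makes [refl_mx i] norm y - e_ii. The product of these two Hermitian
   matrices is then Hermitian, so they commute; hence [y] is diagonal. *)
have comm i : delta_mx i i *m y = y *m delta_mx i i.
  have nr : norming (refl_mx i) (y - delta_mx i i).
    split; first exact: refl_mx_unitary.
    apply/eqP; rewrite eq_le tn_ge /=; last exact: refl_mx_unitary.
    rewrite cr eqd h; last exact: rank1_delta1.
    exact: tn_rdiag_sub.
  have := norming_hermitian nr; rewrite adjmxM.
  have -> : (y - delta_mx i i)^H = y - delta_mx i i.
    by rewrite adjmxD adjmxN adj_delta yH.
  have -> : (refl_mx i)^H = refl_mx i by exact: adj_refl_mx.
  rewrite /refl_mx (mulmxBr (y - delta_mx i i)) (mulmxBl _ _ (y - delta_mx i i)) mulmx1 mul1mx.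
  move=> /addrI /oppr_inj.
  rewrite -scalemxAl -scalemxAr => /scalerI; rewrite pnatr_eq0 => /(_ isT).
  by rewrite mulmxBl mulmxBr mul_delta_mx => /addIr ->.
apply/matrixP => i j; rewrite !mxE; case: (eqVneq i j) => [<-|ij].
  rewrite mulr1n; apply/eqP; rewrite eq_complex /= eqd eqxx /=.
  have := congr1 (fun z : 'M[C]_n => complex.Im (z i i)) yH; rewrite /= adjmxE.
  by case: (y i i) => a b /= hb; apply/eqP; lra.
have := congr1 (fun z : 'M[C]_n => z i j) (comm i).
rewrite /= !mxE (bigD1 i) //= big1 ?addr0; last by move=> k ki; rewrite mxE (negPf ki) andbF mul0r.
rewrite big1; last by move=> k _; rewrite mxE [j == i]eq_sym (negPf ij) andbF mulr0.
by rewrite mxE !eqxx mul1r mulr0n.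
Qed.

Lemma sphere_determined n (x y : 'M[C]_n) : tn x = 1 -> tn y = 1 ->
  (forall a, rank1 a -> tn (y - a) = tn (x - a)) -> y = x.
Proof.
have [u [v [d [uU vU d0 ->]]]] := svd x; rewrite tn_svd // => sd y1 h.
have uHU := unitary_adj uU; have vHU := unitary_adj vU.
have tE z : tn (u^H *m z *m v^H) = tn z by rewrite (tnMr _ vHU) (tnMl _ uHU).
suff E : u^H *m y *m v^H = rdiag d.
  rewrite -E !mulmxA (unitaryP uU) mul1mx -mulmxA (unitary_adjK vU) mulmx1.
  by [].
apply: rdiag_determined => //; first by rewrite tE.
move=> a ra; have := h _ (rank1_unitary uU vU ra).
have inv z : u^H *m (u *m z *m v) *m v^H = z.
  by rewrite !mulmxA (unitary_adjK uU) mul1mx -mulmxA (unitaryP vU) mulmx1.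
by rewrite -[LHS]tE -[RHS]tE !mulmxBr !mulmxBl !inv.
Qed.

Lemma map_conjK n (a : 'M[C]_n) : map_mx Num.conj (map_mx Num.conj a) = a.
Proof. by apply/matrixP => i j; rewrite !mxE conjCK. Qed.

(** Every rank-one a is u phi(b) v = f(b) with b of rank one, so f(x) and u phi(x) v have equal
    distances to it, and [sphere_determined] applies. *)
Lemma standard_extends n (f : 'M[C]_n -> 'M[C]_n) :
  (forall x, tn x = 1 -> tn (f x) = 1) ->
  (forall x y, tn x = 1 -> tn y = 1 -> tn (f x - f y) = tn (x - y)) ->
  standard_on (@rank1) f -> standard_on (fun m (x : 'M[C]_m) => tn x = 1) f.
Proof.
move=> f1 fi [u [v [uU vU h]]]; exists u, v; split=> //.
have uHU := unitary_adj uU; have vHU := unitary_adj vU.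
have tE z : tn (u *m z *m v) = tn z by rewrite (tnMr _ vU) (tnMl _ uU).
have ext (phi : 'M[C]_n -> 'M[C]_n) : involutive phi -> {morph phi : x y / x - y} ->
    (forall x, tn (phi x) = tn x) -> (forall a, rank1 a -> rank1 (phi a)) ->
    (forall a, rank1 a -> f a = u *m phi a *m v) ->
    forall x, tn x = 1 -> f x = u *m phi x *m v.
  move=> phiK phiB phit phir fphi x x1.
  apply: sphere_determined; [by rewrite tE phit | exact: f1 |].
  move=> a ra; pose b := phi (u^H *m a *m v^H).
  have rb : rank1 b by apply/phir/rank1_unitary.
  have -> : a = u *m phi b *m v.
    rewrite /b phiK !mulmxA (unitaryP uU) mul1mx -mulmxA (unitary_adjK vU) mulmx1.
    by [].
  rewrite -{1}(fphi b rb) fi ?(tn_rank1 rb) //.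
  by rewrite -mulmxBl -mulmxBr tE -phiB phit.
case: h => h; [constructor 1 | constructor 2 | constructor 3 | constructor 4].
- by apply: (ext id).
- apply: (ext (@trmx C n n)) => //.
  + exact: trmxK.
  + by move=> a b; rewrite linearB.
  + exact: tnT.
  + exact: rank1T.
- apply: (ext (fun a => map_mx Num.conj a)) => //.
  + exact: map_conjK.
  + by move=> a b; rewrite map_mxB.
  + by move=> a; rewrite -adjmxT tnT tnJ.
  + by move=> a ra; rewrite -adjmxT; apply/rank1T/rank1J.
- apply: (ext (@adjmx R n n)) => //.
  + exact: adjmxK.
  + by move=> a b; rewrite adjmxD adjmxN.
  + exact: tnJ.
  + exact: rank1J.
Qed.

Theorem matrix_tingley n (f : 'M[C]_n -> 'M[C]_n) :
  (forall x, tn x = 1 -> tn (f x) = 1) ->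
  (forall x y, tn x = 1 -> tn y = 1 -> tn (f x - f y) = tn (x - y)) ->
  (forall y, tn y = 1 -> exists2 x, tn x = 1 & f x = y) ->
  standard_on (fun m (x : 'M[C]_m) => tn x = 1) f.
Proof.
move=> f1 fi fs; have [n0|n0] := posnP n.
  (* In dimension 0 the sphere is empty, since the only matrix has norm 0. *)
  exists 1%:M, 1%:M; split; [exact: unitary1 | exact: unitary1 | constructor 1 => x].
  have xU : unitary x.
    by split; apply/matrixP => i; exfalso; have := leq_ltn_trans (leq0n i) (ltn_ord i); rewrite n0.
  have x0 : tn x = 0 by rewrite (tn_unitary xU) n0.
  by rewrite x0 => /eqP; rewrite eq_sym oner_eq0.
apply: standard_extends => //; apply: rank1_isometry_standard => //; split=> [a|a b ra rb].
  exact: rank1_iso.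
have a1 := tn_rank1 ra; have b1 := tn_rank1 rb; split; last exact: fi.
(* The norm of a sum is the distance from a to - b, and f(-b) = - f(b). *)
have Nb : tn (- b) = 1 by rewrite tnN.
by have := fi a (- b) a1 Nb; rewrite (rank1_isoN f1 fi fs n0 rb) !opprK.
Qed.

End TraceNormMatrices.

(** * From operators to matrices *)

Section Operators.
Variables (R : realType) (H : vectType R[i]) (dot : {dot H for Num.conj}).
Local Notation C := R[i].
Local Notation re := (@complex.Re R).
Local Notation "x %:C" := (real_complex R x).

Section Basis.
Variables (e : (\dim {:H}).-tuple H) (eP : orthonormal_basis dot e).
Local Notation n := (\dim {:H}).
Let eB : basis_of fullv e := proj1 eP.

Lemma opmxE (a : 'End(H)) : opmx dot e a = (mxof e e a)^T.
Proof.
apply/matrixP => i j; rewrite !mxE /= vecof_delta.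
have E k : tnth e k = e`_k by rewrite (tnth_nth 0).
by rewrite !E (dot_rVof eP) (rVofE eB i) trmx_delta map_delta_mx -colE !mxE.
Qed.

Definition mxop (x : 'M[C]_n) : 'End(H) := hommx e e x^T.

Lemma opmxK : cancel (opmx dot e) mxop.
Proof. by move=> a; rewrite /mxop opmxE trmxK (mxofK eB eB). Qed.

Lemma mxopK : cancel mxop (opmx dot e).
Proof. by move=> x; rewrite /mxop opmxE (hommxK eB eB) trmxK. Qed.

Lemma opmxB a b : opmx dot e (a - b) = opmx dot e a - opmx dot e b.
Proof. by rewrite !opmxE (linearB (mxof e e)) linearB. Qed.

Lemma optrace_mxof b : optrace b = \tr (mxof e e b).
Proof.
have vB := vbasisP (fullv : {vspace H}).
pose P := mxof e (vbasis fullv) \1; pose Q := mxof (vbasis fullv) e \1.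
have QP : Q *m P = 1%:M.
  rewrite -(mxof_comp (vbasis fullv) (vbasis fullv) eB) comp_lfun1l mxof1 //; exact: basis_free vB.
have -> : mxof e e b = P *m mxof (vbasis fullv) (vbasis fullv) b *m Q.
  rewrite -(mxof_comp e (vbasis fullv) vB) -(mxof_comp e e vB) comp_lfun1r comp_lfun1l.
  by [].
by rewrite mxtrace_mulC mulmxA QP mul1mx.
Qed.

Lemma trnorm_tn (a : 'End(H)) : trnorm dot a = (tn (opmx dot e a))%:C.
Proof.
rewrite opmxE tnT; set M := mxof e e a.
have [u [v [d [uU vU d0 EM]]]] := svd M.
(* [M] acts on row vectors, so a^* a has matrix M M^H, whose positive square root is u D u^H. *)
pose B := u *m rdiag d *m u^H.
have BB : B *m B = M *m M^H.
  rewrite EM /B !adjmxM adj_rdiag -!mulmxA (mulmxA (u^H)) (unitary_adjK uU) mul1mx.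
  by rewrite (mulmxA v) (unitaryP vU) mul1mx.
have ab : is_abs dot a (hommx e e B).
  split.
    move=> x; rewrite (dot_rVof eP) -(rVof_mul eB eB) /B.
    set z := rVof e x; pose w := z *m u.
    have -> : z *m (u *m rdiag d *m u^H) *m z^t* = w *m rdiag d *m w^H.
      have -> : z^t* = z^H by rewrite adjmx.unlock.
      by rewrite /w adjmxM !mulmxA.
    clearbody w; rewrite mxE sumr_ge0 // => i _; rewrite mul_mx_diag !mxE adjmxE mulrAC sqnE.
    by rewrite -rmorphM /= ler0c mulr_ge0 // sqn_ge0.
  have -> : adjoint dot a = hommx e e (M^H).
    by rewrite adjmx.unlock; apply/esym/adjoint_uniq/is_adjoint_ex.
  rewrite -(hommx_mul eB eB eB B B) BB (hommx_mul eB eB eB).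
  by rewrite /M (mxofK eB eB).
rewrite /trnorm -(absop_uniq ab) optrace_mxof (hommxK eB eB) EM tn_svd //.
rewrite /B mxtrace_mulC mulmxA (unitary_adjK uU) mul1mx /rdiag mxtrace_diag -realC_sum.
by apply: eq_bigr => i _; rewrite mxE.
Qed.

End Basis.
End Operators.

Theorem theorem3p7 (R : realType) (H : vectType R[i]) (dot : {dot H for Num.conj})
  (n : nat) (e : n.-tuple H) (e_onb : orthonormal_basis dot e)
  (f : trsphere dot -> trsphere dot)
  (f_surj : forall y, exists x, f x = y)
  (f_isom : forall x y : trsphere dot,
     trnorm dot (sval (f x) - sval (f y)) = trnorm dot (sval x - sval y)) :
  (exists T : 'End(H) -> 'End(H),
     [/\ forall b, exists a, T a = b,
         trnorm_isometry dot T,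
         linear T \/ conj_linear T
       & forall x : trsphere dot, sval (f x) = T (sval x)])
  /\
  (exists u v : 'M[R[i]]_n,
     [/\ u \is unitarymx, v \is unitarymx &
      [\/ forall x : trsphere dot,
            opmx dot e (sval (f x)) = u *m opmx dot e (sval x) *m v,
          forall x : trsphere dot,
            opmx dot e (sval (f x)) = u *m (opmx dot e (sval x))^T *m v,
          forall x : trsphere dot,
            opmx dot e (sval (f x)) = u *m map_mx Num.conj (opmx dot e (sval x)) *m v
        | forall x : trsphere dot,
            opmx dot e (sval (f x)) = u *m (opmx dot e (sval x)) ^t* *m v]]).
Proof.
have nd : n = \dim {:H} by rewrite -(size_basis e_onb.1).
subst n.
(* [g] is [f] read in matrices, with the value 0 off the sphere. *)
have /choice [g gP] : forall x, exists y, forall s : trsphere dot,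
    opmx dot e (sval s) = x -> opmx dot e (sval (f s)) = y.
  move=> x; have [[s sx]|no] := EM (exists s : trsphere dot, opmx dot e (sval s) = x).
    exists (opmx dot e (sval (f s))) => t tx; congr (opmx dot e (sval (f _))).
    by apply/val_inj/(can_inj (opmxK e_onb)); rewrite sx -tx.
  by exists 0 => s sx; case: no; exists s.
have gE s : opmx dot e (sval (f s)) = g (opmx dot e (sval s)) by exact: gP.
have sP (s : trsphere dot) : tn (opmx dot e (sval s)) = 1.
  apply: complexI; rewrite -(trnorm_tn e_onb); apply/eqP; exact: (svalP s).
have sE x : tn x = 1 -> exists s : trsphere dot, opmx dot e (sval s) = x.
  move=> x1; have x1' : trnorm dot (mxop e x) == 1.
    by rewrite (trnorm_tn e_onb) (mxopK e_onb) x1.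
  by exists (exist _ (mxop e x) x1'); rewrite /= (mxopK e_onb).
have gI : standard_on (fun m (x : 'M[R[i]]_m) => tn x = 1) g.
  apply: matrix_tingley.
  - by move=> x /sE [s <-]; rewrite -gE.
  - move=> x y /sE [s <-] /sE [t <-]; rewrite -!gE -!(opmxB e_onb).
    by apply: complexI; rewrite -!(trnorm_tn e_onb) f_isom.
  - move=> y /sE [t <-]; have [s <-] := f_surj t.
    by exists (opmx dot e (sval s)); rewrite ?gE.
have [u [v [uU vU h]]] := gI.
split; last first.
  exists u, v; split; [exact/unitarymxE | exact/unitarymxE |].
  case: h => h; [constructor 1 | constructor 2 | constructor 3 | constructor 4]
    => s; rewrite gE h //.
  by rewrite adjmx.unlock.
have uHU := unitary_adj uU; have vHU := unitary_adj vU.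
(* The formula for [g] makes sense on all matrices and defines [T]; surjectivity comes from the
   involution [phi], the isometry property from its additivity. *)
have ok (phi : 'M[R[i]]_(\dim {:H}) -> 'M[R[i]]_(\dim {:H})) :
    involutive phi -> {morph phi : x y / x - y} -> (forall x, tn (phi x) = tn x) ->
    (forall x, tn x = 1 -> g x = u *m phi x *m v) ->
    let T a := mxop e (u *m phi (opmx dot e a) *m v) in
    linear T \/ conj_linear T ->
    exists T : 'End(H) -> 'End(H),
     [/\ forall b, exists a, T a = b, trnorm_isometry dot T, linear T \/ conj_linear T
       & forall x : trsphere dot, sval (f x) = T (sval x)].
  move=> phiK phiB phit gphi T Tl; exists T.
  have TE a : opmx dot e (T a) = u *m phi (opmx dot e a) *m v by exact: mxopK.
  clearbody T; split=> //.
  - move=> b; exists (mxop e (phi (u^H *m opmx dot e b *m v^H))).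
    apply: (can_inj (opmxK e_onb)); rewrite TE (mxopK e_onb) phiK.
    by rewrite !mulmxA (unitaryP uU) mul1mx -mulmxA (unitary_adjK vU) mulmx1.
  - move=> a b; rewrite (trnorm_tn e_onb (T a - T b)) (trnorm_tn e_onb (a - b)).
    rewrite (opmxB e_onb (T a) (T b)) (opmxB e_onb a b) (TE a) (TE b).
    by rewrite -mulmxBl -mulmxBr (tnMr _ vU) (tnMl _ uU) -phiB phit.
  - move=> x; apply: (can_inj (opmxK e_onb)); by rewrite gE gphi ?TE.
have lin : linear (fun x => mxop e (u *m x *m v)).
  move=> k x y; rewrite /mxop mulmxDr mulmxDl -scalemxAr -scalemxAl.
  by rewrite linearP (linearP (hommx e e)).
have oplin : linear (opmx dot e).
  by move=> k a b; rewrite !(opmxE e_onb) (linearP (mxof e e)) linearP.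
case: h => h.
- apply: (ok id) => //; left=> k a b; rewrite /= oplin lin //.
- apply: (ok (@trmx _ _ _)) => //.
  + exact: trmxK.
  + by move=> a b; rewrite linearB.
  + exact: tnT.
  + by left=> k a b; rewrite /= oplin linearP lin.
- apply: (ok (fun x => map_mx Num.conj x)) => //.
  + exact: map_conjK.
  + by move=> a b; rewrite map_mxB.
  + by move=> a; rewrite -adjmxT tnT tnJ.
  + by right=> k a b; rewrite /= oplin map_mxD map_mxZ lin.
- apply: (ok (@adjmx _ _ _)) => //.
  + exact: adjmxK.
  + by move=> a b; rewrite adjmxD adjmxN.
  + exact: tnJ.
  + by right=> k a b; rewrite /= oplin adjmxD adjmxZ lin.
Qed.
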